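(* Let $F$ be a field of characteristic zero. For any real $\alpha>1$, there exists a (not necessarily associative) $F$-algebra $R_\alpha$ with $\underline{exp}(R_\alpha)=1$ and $\overline{exp}(R_\alpha)=\alpha$ such that $\underline{exp}(R_\alpha^\sharp)=2$ and $\alpha\le\overline{exp}(R_\alpha^\sharp)\le\alpha+1$.
   Context: Algebras are over a field $F$ of characteristic zero, not necessarily associative, unital or finite-dimensional. Let $F\{X\}$ be the free (non-associative) $F$-algebra on a countably infinite set $X=\{x_1,x_2,\ldots\}$ of free generators, and let $Id(A)\subset F\{X\}$ be the ideal of all polynomial identities of an algebra $A$. Let $P_n=P_n(x_1,\ldots,x_n)$ be the subspace of $F\{X\}$ of all multilinear polynomials in $x_1,\ldots,x_n$ (each monomial, with any arrangement of brackets, containing each of $x_1,\ldots,x_n$ exactly once). The $n$-th codimension of $A$ is $$c_n(A)=\dim\frac{P_n}{P_n\cap Id(A)},\quad n=1,2,\ldots.$$ If the sequence $\{c_n(A)\}$ is exponentially bounded, the lower and upper PI-exponents of $A$ are $$\underline{exp}(A)=\liminf_{n\to\infty}\sqrt[n]{c_n(A)},\qquad \overline{exp}(A)=\limsup_{n\to\infty}\sqrt[n]{c_n(A)}.$$ For an algebra $A$, $A^\sharp$ denotes the algebra obtained from $A$ by adjoining an external unit, i.e. $A^\sharp=F\cdot 1\oplus A$ as a vector space, where $1$ acts as a two-sided identity element and $A$ is an ideal with its original multiplication. *)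

(* Defs.v *)
From HB Require Import structures.
From mathcomp Require Import all_boot all_order all_algebra.
From mathcomp Require Import finmap.
From mathcomp.multinomials Require Import monalg.
From mathcomp Require Import all_classical all_reals all_analysis.

Set Implicit Arguments.
Unset Strict Implicit.
Unset Printing Implicit Defensive.

Import Order.TTheory GRing.Theory Num.Theory.

Local Open Scope classical_set_scope.
Local Open Scope ring_scope.

(* Not necessarily associative, commutative, unital or finite-dimensional. *)
Record naAlgType (F : fieldType) := NaAlg {
  na_sort :> lmodType F;
  na_mul : {bilinear na_sort -> na_sort -> na_sort}
}.

Section Unitization.
Variables (F : fieldType) (A : naAlgType F).

Definition unitization_mul (u v : (F^o * A)%type) : (F^o * A)%type :=
  (u.1 * v.1, u.1 *: v.2 + v.1 *: u.2 + na_mul A u.2 v.2).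

Lemma unitization_mul_bilinear :
  bilinear_for *:%R *:%R unitization_mul.
Proof.
split=> [v|u] a x y; rewrite /unitization_mul /=; congr (_, _) => /=.
- by rewrite mulrDl -scalerAl.
- rewrite linearPl !scalerDl !scalerDr !scalerA /= [a *: x.1]/(a * x.1).
  by rewrite [v.1 * a]mulrC (addrACA (_ *: _)) [LHS]addrACA.
- by rewrite mulrDr -scalerAr.
- rewrite linearPr !scalerDl !scalerDr !scalerA /= [a *: x.1]/(a * x.1).
  by rewrite [u.1 * a]mulrC (addrACA (_ *: _)) [LHS]addrACA.
Qed.

HB.instance Definition _ :=
  bilinear_isBilinear.Build F (F^o * A)%type (F^o * A)%type (F^o * A)%type
    *:%R *:%R unitization_mul unitization_mul_bilinear.

Definition unitization : naAlgType F := @NaAlg F (F^o * A)%type unitization_mul.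

Lemma unitization_mul1u (u : unitization) : na_mul unitization (1, 0) u = u.
Proof.
by case: u => c x; rewrite /= /unitization_mul /= linear0l scaler0 !addr0 mul1r scale1r.
Qed.

Lemma unitization_mulu1 (u : unitization) : na_mul unitization u (1, 0) = u.
Proof.
by case: u => c x; rewrite /= /unitization_mul /= linear0r scaler0 add0r addr0 mulr1 scale1r.
Qed.

End Unitization.

Inductive monomial := Var of nat | Node of monomial & monomial.

Fixpoint tree_of_monomial (m : monomial) : GenTree.tree nat :=
  match m with
  | Var i => GenTree.Leaf i
  | Node m1 m2 => GenTree.Node 0 [:: tree_of_monomial m1; tree_of_monomial m2]
  end.

Fixpoint monomial_of_tree (t : GenTree.tree nat) : option monomial :=
  match t with
  | GenTree.Leaf i => Some (Var i)
  | GenTree.Node 0 [:: t1; t2] =>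
      if (monomial_of_tree t1, monomial_of_tree t2) is (Some m1, Some m2)
      then Some (Node m1 m2) else None
  | _ => None
  end.

Lemma tree_of_monomialK : pcancel tree_of_monomial monomial_of_tree.
Proof. by elim=> //= m1 -> m2 ->. Qed.

HB.instance Definition _ := Countable.copy monomial (pcan_type tree_of_monomialK).

Fixpoint leaves (m : monomial) : seq nat :=
  match m with
  | Var i => [:: i]
  | Node m1 m2 => leaves m1 ++ leaves m2
  end.

Section FreeAlgebra.
Variable F : fieldType.

Definition linext (V : lmodType F) (h : monomial -> V)
    (f : {malg F[monomial]}) : V :=
  \sum_(m <- msupp f) f@_m *: h m.

Section LinextTheory.
Variable V : lmodType F.
Implicit Types (h : monomial -> V) (f g : {malg F[monomial]}).

Lemma linextEw (D : {fset monomial}) h f :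
  (msupp f `<=` D)%fset -> linext h f = \sum_(m <- D) f@_m *: h m.
Proof.
move=> sfD; rewrite /linext (big_fset_incl _ sfD) // => m _ mNf.
by rewrite mcoeff_outdom // scale0r.
Qed.

Lemma linext_is_linear h : linear (linext h).
Proof.
move=> a f g; pose D := (msupp f `|` msupp g `|` msupp (a *: f + g))%fset.
have sfD : (msupp f `<=` D)%fset by rewrite /D -fsetUA fsubsetUl.
have sgD : (msupp g `<=` D)%fset.
  by apply: fsubset_trans (fsubsetUl _ _); rewrite fsubsetUr.
have sfgD : (msupp (a *: f + g) `<=` D)%fset by rewrite fsubsetUr.
rewrite (linextEw _ sfD) (linextEw _ sgD) (linextEw _ sfgD).
rewrite scaler_sumr -big_split /=; apply: eq_bigr => m _.
by rewrite mcoeffD mcoeffZ scalerDl scalerA.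
Qed.

HB.instance Definition _ h :=
  GRing.isLinear.Build F {malg F[monomial]} V *:%R (linext h)
    (linext_is_linear h).

Lemma linextU h m : linext h << m >> = h m.
Proof.
rewrite (@linextEw [fset m]%fset) ?msuppU_le //.
by rewrite big_seq_fset1 mcoeffUU scale1r.
Qed.

Lemma linext_linear_fun f a h1 h2 :
  linext (fun m => a *: h1 m + h2 m) f = a *: linext h1 f + linext h2 f.
Proof.
rewrite /linext scaler_sumr -big_split; apply: eq_bigr => m _ /=.
by rewrite scalerDr !scalerA mulrC.
Qed.

End LinextTheory.

Definition free_mul (f g : {malg F[monomial]}) : {malg F[monomial]} :=
  linext (fun m1 => linext (fun m2 => << Node m1 m2 >>) g) f.

Lemma free_mul_bilinear : bilinear_for *:%R *:%R free_mul.
Proof.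
split=> [g|f] a x y; first exact: linearP.
rewrite /free_mul -linext_linear_fun.
by congr linext; apply/funext => m; rewrite linearP.
Qed.

HB.instance Definition _ :=
  bilinear_isBilinear.Build F {malg F[monomial]} {malg F[monomial]}
    {malg F[monomial]} *:%R *:%R free_mul free_mul_bilinear.

Definition freeAlg : naAlgType F := @NaAlg F {malg F[monomial]} free_mul.

End FreeAlgebra.

Section Identities.
Variables (F : fieldType) (A : naAlgType F).

Fixpoint eval_monomial (a : nat -> A) (m : monomial) : A :=
  match m with
  | Var i => a i
  | Node m1 m2 => na_mul A (eval_monomial a m1) (eval_monomial a m2)
  end.

Definition eval (a : nat -> A) (f : freeAlg F) : A :=
  linext (eval_monomial a) f.

Lemma evalM (a : nat -> A) (f g : freeAlg F) :
  eval a (na_mul (freeAlg F) f g) = na_mul A (eval a f) (eval a g).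
Proof.
rewrite /eval /= /free_mul {3}/linext linear_sumlz {2}/linext linear_sum /=.
apply: eq_bigr => m _; rewrite linearZ linearZl_LR /=; congr (_ *: _).
rewrite {2}/linext linear_sum linear_sumr; apply: eq_bigr => k _ /=.
by rewrite linearZ linearZr_LR /= linextU.
Qed.

Definition Id : set (freeAlg F) := [set f | forall a : nat -> A, eval a f = 0].

End Identities.

Section QuotientBasis.
Variables (F : fieldType) (V : lmodType F).
Implicit Types (P I : set V) (d : nat).

Definition subspace P := P 0 /\ forall a u v, P u -> P v -> P (a *: u + v).

(* For subspaces P and I, the classes of the b i form a basis of P / (P `&` I). *)
Definition quotient_basis P I d (b : 'I_d -> V) : Prop :=
  [/\ forall i, P (b i),
      forall c : 'I_d -> F,
        (P `&` I) (\sum_i c i *: b i) -> forall i, c i = 0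
    & forall v, P v -> exists c : 'I_d -> F, (P `&` I) (v - \sum_i c i *: b i)].

Definition quotient_dim P I : nat :=
  xget 0%N [set d | exists b : 'I_d -> V, quotient_basis P I b].

Lemma subspaceD P u v : subspace P -> P u -> P v -> P (u + v).
Proof. by move=> [_ PD] Pu Pv; rewrite -[u]scale1r; apply: PD. Qed.

Lemma subspaceZ P a u : subspace P -> P u -> P (a *: u).
Proof. by move=> [P0 PD] Pu; rewrite -[_ *: _]addr0; apply: PD. Qed.

Lemma subspaceB P u v : subspace P -> P u -> P v -> P (u - v).
Proof.
by move=> Ps Pu Pv; apply: subspaceD => //; rewrite -scaleN1r; apply: subspaceZ.
Qed.

Lemma subspace_sum P (J : Type) (r : seq J) (E : J -> V) :
  subspace P -> (forall j, P (E j)) -> P (\sum_(j <- r) E j).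
Proof.
move=> Ps PE; elim/big_ind: _ => //; first by case: Ps.
by move=> u v; apply: subspaceD.
Qed.

Lemma subspaceI P I : subspace P -> subspace I -> subspace (P `&` I).
Proof.
move=> [P0 PD] [I0 ID]; split=> // a u v [Pu Iu] [Pv Iv].
by split; [apply: PD|apply: ID].
Qed.

Lemma quotient_basis_leq P I d1 d2 (b1 : 'I_d1 -> V) (b2 : 'I_d2 -> V) :
  subspace P -> subspace I ->
  quotient_basis P I b1 -> quotient_basis P I b2 -> (d1 <= d2)%N.
Proof.
move=> Ps Is [Pb1 free1 _] [_ _ span2]; have PIs := subspaceI Ps Is.
have /choice[C CE] i := span2 _ (Pb1 i).
pose M := \matrix_(i, j) C i j.
rewrite leqNgt; apply/negP => d21.
have : kermx M != 0.
  by rewrite kermx_eq0 /row_free neq_ltn (leq_ltn_trans (rank_leq_col _)).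
case/rowV0Pn => u /sub_kermxP uM0 /eqP[]; apply/rowP => i; rewrite mxE.
move: i; apply: (free1 (u 0)).
suff -> : \sum_i u 0 i *: b1 i =
    \sum_i u 0 i *: (b1 i - \sum_j C i j *: b2 j).
  by apply: subspace_sum => // i; apply: subspaceZ.
rewrite -[LHS]subr0 -[X in _ - X]/(0 : V).
under [RHS]eq_bigr do rewrite scalerBr.
rewrite sumrB; congr (_ - _).
under eq_bigr do rewrite scaler_sumr.
rewrite exchange_big big1 //= => j _.
under eq_bigr do rewrite scalerA.
rewrite -scaler_suml; have /rowP/(_ j) := uM0; rewrite !mxE => uMj.
rewrite (_ : \sum_i _ = 0) ?scale0r // -[RHS]uMj.
by apply: eq_bigr => i _; rewrite mxE.
Qed.

Lemma quotient_dimE P I d (b : 'I_d -> V) :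
  subspace P -> subspace I -> quotient_basis P I b -> quotient_dim P I = d.
Proof.
move=> Ps Is bP; rewrite /quotient_dim; case: xgetP => [k _ [b' b'P]|/(_ d)[]].
  apply/eqP; rewrite eqn_leq.
  by rewrite (quotient_basis_leq Ps Is b'P bP) (quotient_basis_leq Ps Is bP b'P).
by exists b.
Qed.

Lemma quotient_basis_exists P I (s : seq V) :
  subspace P -> subspace I -> (forall v, v \in s -> P v) ->
  (forall v, P v -> exists c : V -> F, v = \sum_(w <- s) c w *: w) ->
  exists d (b : 'I_d -> V), quotient_basis P I b.
Proof.
move=> Ps Is sP sspan; have PIs := subspaceI Ps Is.
suff [d [b [Pb bfree bs]]] : exists d (b : 'I_d -> V),
    [/\ forall i, P (b i),
      forall c, (P `&` I) (\sum_i c i *: b i) -> forall i, c i = 0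
    & forall v, v \in s -> exists c, (P `&` I) (v - \sum_i c i *: b i)].
  exists d, b; split=> // v /sspan[c ->].
  have {}bs v0 : exists c, v0 \in s -> (P `&` I) (v0 - \sum_i c i *: b i).
    have [/bs[c0 ?]|_] := boolP (v0 \in s); first by exists c0.
    by exists (fun=> 0).
  have /choice[C CE] := bs.
  exists (fun i => \sum_(w <- s) c w * C w i).
  rewrite [X in _ - X](_ : _ = \sum_(w <- s) c w *: \sum_i C w i *: b i).
    rewrite -sumrB big_seq; elim/big_ind: _ => [|u w|w ws].
    - by case: PIs.
    - exact: subspaceD.
    - by rewrite -scalerBr; apply: subspaceZ => //; apply: CE.
  under [RHS]eq_bigr do rewrite scaler_sumr.
  rewrite exchange_big; apply: eq_bigr => i _ /=.
  by rewrite scaler_suml; apply: eq_bigr => w _; rewrite scalerA.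
elim: s {sspan} sP => [|e s IHs] sP.
  by exists 0%N, (fun=> 0); split; [case|move=> c _ []|].
have [|d [b [Pb bfree bs]]] := IHs.
  by move=> v vs; apply: sP; rewrite inE vs orbT.
have [[c ec]|eN] := pselect (exists c, (P `&` I) (e - \sum_i c i *: b i)).
  exists d, b; split=> // v; rewrite inE => /orP[/eqP->|/bs//].
  by exists c.
exists d.+1, (fun i => oapp b e (unlift ord0 i)).
have sumE (c : 'I_d.+1 -> F) :
    \sum_i c i *: oapp b e (unlift ord0 i) =
    c ord0 *: e + \sum_i c (lift ord0 i) *: b i.
  rewrite big_ord_recl unlift_none /=; congr (_ + _).
  by apply: eq_bigr => i _; rewrite liftK.
split.
- by move=> i; case: unliftP => [j _|_] //=; apply: sP; rewrite mem_head.
- move=> c; rewrite sumE => cPI.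
  have c0 : c ord0 = 0.
    apply/eqP/negPn/negP => cN0; apply: eN.
    exists (fun i => - ((c ord0)^-1 * c (lift ord0 i))).
    have := subspaceZ (c ord0)^-1 PIs cPI.
    rewrite scalerDr scalerA mulVf // scale1r scaler_sumr -sumrN.
    congr ((P `&` I) (_ + _)); apply: eq_bigr => i _.
    by rewrite scaleNr opprK scalerA.
  move: cPI; rewrite c0 scale0r add0r => /bfree cl i.
  by case: (unliftP ord0 i) => [j ->|->].
- move=> v; rewrite inE => /orP[/eqP->|/bs[c cP]].
    exists (fun i => (i == ord0)%:R); rewrite sumE eqxx scale1r.
    rewrite big1 ?addr0 ?subrr; first by case: PIs.
    by move=> i _; rewrite scale0r.
  exists (fun i => oapp c 0 (unlift ord0 i)).
  rewrite sumE unlift_none /= scale0r add0r.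
  by under eq_bigr do rewrite liftK.
Qed.

End QuotientBasis.

Section Codimension.
Variables (F : fieldType) (A : naAlgType F).

(* The generators x_1, ..., x_n are Var 0, ..., Var n.-1. *)
Definition multilinear (n : nat) : pred monomial :=
  fun m => perm_eq (leaves m) (iota 0 n).

Definition Pn (n : nat) : set (freeAlg F) :=
  [set f | {in msupp f, forall m, multilinear n m}].

Definition codim (n : nat) : nat := quotient_dim (Pn n) (Id A).

Lemma subspace_Id : subspace (Id A).
Proof.
split=> [a|c f g f0 g0 a]; rewrite /eval; first exact: linear0.
by rewrite linearP /= -!/(eval _ _) f0 g0 scaler0 addr0.
Qed.

Lemma subspace_Pn n : subspace (Pn n).
Proof.
split=> [m|c f g Pf Pg m]; first by rewrite msupp0 in_fset0.
move=> /(fsubsetP (msuppD_le _ _)); rewrite in_fsetU => /orP[|/Pg//].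
by move=> /(fsubsetP (msuppZ_le _ _)) /Pf.
Qed.

Lemma multilinear_finite n :
  exists s : seq monomial, uniq s /\ (forall m, (m \in s) = multilinear n m).
Proof.
pose all_mon := fix all_mon h : seq monomial := if h is h'.+1 then
   [seq Var i | i <- iota 0 n] ++
   [seq Node m1 m2 | m1 <- all_mon h', m2 <- all_mon h'] else [::].
have all_monP h m : (size (leaves m) <= h)%N ->
    {subset leaves m <= iota 0 n} -> m \in all_mon h.
  have leaves_gt0 k : (0 < size (leaves k))%N.
    by elim: k => //= k1 k1_gt0 k2 _; rewrite size_cat addn_gt0 k1_gt0.
  elim: h m => [|h IHh] m; first by rewrite leqNgt leaves_gt0.
  case: m => [i|m1 m2] /= hm sm; rewrite mem_cat; apply/orP; [left|right].
    by apply: map_f; apply: sm; rewrite mem_head.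
  move: hm; rewrite size_cat => hm; apply/allpairsP; exists (m1, m2).
  split=> //=; apply: IHh.
  - by rewrite -ltnS (leq_trans _ hm) // -addn1 leq_add2l.
  - by move=> i im; apply: sm; rewrite mem_cat im.
  - by rewrite -ltnS (leq_trans _ hm) // -add1n leq_add2r.
  - by move=> i im; apply: sm; rewrite mem_cat im orbT.
exists (undup [seq m <- all_mon n | multilinear n m]).
split=> [|m]; first exact: undup_uniq.
rewrite mem_undup mem_filter andb_idr // => mP; apply: all_monP.
  by rewrite (perm_size mP) size_iota.
by move=> i; rewrite (perm_mem mP).
Qed.

Lemma codim_basis n :
  exists b : 'I_(codim n) -> freeAlg F, quotient_basis (Pn n) (Id A) b.
Proof.
have [s [us sE]] := multilinear_finite n.
have [] := @quotient_basis_exists F (freeAlg F) (Pn n) (Id A)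
  [seq << m >> | m <- s] (subspace_Pn n) subspace_Id.
- move=> f /mapP[m ms ->] k.
  by move=> /(fsubsetP msuppU_le); rewrite in_fset1 => /eqP->; rewrite -sE.
- move=> f Pf; exists (fun w => \sum_(m <- s) f@_m * w@_m).
  rewrite big_map; transitivity (\sum_(m <- s) f@_m *: (<< m >> : freeAlg F)).
    apply/malgP => k; rewrite raddf_sum /=.
    have [ks|kNs] := boolP (k \in s).
      rewrite (bigD1_seq k) //= mcoeffZ mcoeffUU mulr1 big1 ?addr0 // => m.
      by move=> /negPf mk; rewrite mcoeffZ mcoeffU mk mulr0.
    rewrite mcoeff_outdom; last by apply/negP => /Pf; rewrite -sE (negPf kNs).
    rewrite big_seq big1 // => m ms; rewrite mcoeffZ mcoeffU.
    by case: eqP ms kNs => [->->//|_ _ _]; rewrite mulr0.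
  rewrite big_seq [RHS]big_seq; apply: eq_bigr => m ms; congr (_ *: _).
  rewrite (bigD1_seq m) //= mcoeffUU mulr1 big1 ?addr0 // => k /negPf km.
  by rewrite mcoeffU eq_sym km mulr0.
by move=> d [b bP]; rewrite /codim (quotient_dimE (subspace_Pn n) subspace_Id bP); exists b.
Qed.

End Codimension.

Section Exponents.
Variables (F : fieldType) (R : realType) (A : naAlgType F).

Definition codim_root : (\bar R)^nat :=
  fun n => ((codim A n)%:R `^ n%:R^-1)%:E.

(* These are taken in the extended reals, so that asserting that the upper
   exponent is finite includes that the codimensions are exponentially bounded. *)
Definition lower_exp : \bar R := limn_einf codim_root.

Definition upper_exp : \bar R := limn_esup codim_root.

End Exponents.

Arguments lower_exp {F} R A.
Arguments upper_exp {F} R A.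

(* Main.v *)
Require Import Defs.
From HB Require Import structures.
From mathcomp Require Import all_boot all_order all_algebra.
From mathcomp Require Import finmap.
From mathcomp.multinomials Require Import monalg.
From mathcomp Require Import all_classical all_reals all_analysis.
From mathcomp Require Import zify ring lra.
(* Topology also defines a subspace; the linear-algebraic one is meant below. *)
Import Defs.
Import Order.TTheory GRing.Theory Num.Theory.

Set Implicit Arguments.
Unset Strict Implicit.
Unset Printing Implicit Defensive.

Local Open Scope classical_set_scope.
Local Open Scope ring_scope.

(** The algebra is a space of states acted on by letters. A pair (w, v) has a
    state part w, indexed by a track i and a position t, and a letter part v.
    In a product only the state of the left factor and the letters of the right
    factor matter: the state at position t - 1 of track i moves to position t,
    weighted by the coefficient of the letter written there, and track i stops
    at position len i. So only left-normed monomials survive, and evaluating one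
    of degree n reads off n - 1 consecutive letters of a track. On track i the
    multiples t of the period per i carry the special letter t, all other
    positions the common letter 0.

    A multilinear polynomial of degree n is tested on a window of a track by
    sums of coefficients over the permutations that put prescribed variables on
    the special positions; the variables on common letters are interchangeable
    ([eq_word_coord]). A window of a track of period p contains at most n/p + 1
    special letters and there are p kinds of windows, which gives about
    n ^ (n/p) conditions, while the tracks with period at least n or length
    below n account together for at most n ^ 3 ([codim_track_le_cube],
    [codim_track_le_dense]). Conversely, the injections of the special positions
    into the variables give a falling factorial of independent monomials
    ([codim_track_ge]).

    With len i the integer part of alpha ^ per i, every n <= len i satisfies
    n ^ (n/p) <= alpha ^ n, and at n = len i this is nearly attained; hence the
    upper exponent alpha. The next period is so much larger than len i that
    before it is reached the codimensions are at most n ^ 3; hence the lower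
    exponent 1.

    For the algebra with a unit, substituting the unit for some of the variables
    gives c_n(A#) <= 1 + \sum_k C(n, k) c_k(A) ([codim_unitization_le]), and so the
    upper exponent is at most alpha + 1; it is at least alpha because A# has
    fewer identities. At n = per (i + 1) the degrees k > len i + per i contribute at
    most n ^ 3 2 ^ n to the sum, and the remaining ones are negligible since n is
    exponentially larger; hence lower exponent at most 2. Finally the monomials
    z S y S^c, with S running over sets of variables, are separated by sending z to
    a state, y to a special letter, a subset T to the common letter and the
    other variables to 1: the value is nonzero exactly when T is included in S.
    This triangular system gives 2 ^ n <= c_(n+2)(A#)
    ([codim_unitization_track_ge]) and the lower exponent 2. *)

(** * Bounding the dimension of a quotient by linear functionals *)

Section QuotientBounds.
Variables (F : fieldType) (V : lmodType F).
Implicit Types (P I : set V) (phi : V -> F).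

(** Linearity is asked on P only, so that coordinates in P / (P `&` I), which
    make sense on P alone, qualify. *)
Definition linear_on P phi :=
  forall a u v, P u -> P v -> phi (a *: u + v) = a * phi u + phi v.

Lemma linear_on_sum P phi (J : finType) (c : J -> F) (g : J -> V) :
  subspace P -> linear_on P phi -> (forall j, P (g j)) ->
  phi (\sum_j c j *: g j) = \sum_j c j * phi (g j).
Proof.
move=> Ps phil Pg; have P0 : P 0 by case: Ps.
have phi0 : phi 0 = 0.
  by have := phil (-1) 0 0 P0 P0; rewrite scaler0 addr0 mulN1r addNr.
suff [_ ->] : P (\sum_j c j *: g j) /\
  phi (\sum_j c j *: g j) = \sum_j c j * phi (g j) by [].
elim: (index_enum J) => [|j s [IHP IH]]; first by rewrite !big_nil.
rewrite !big_cons; split; last by rewrite phil // IH.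
by case: Ps => _; apply.
Qed.

(** With more basis vectors than functionals some nontrivial combination of the
    former is killed by all the latter, hence lies in I. *)
Lemma quotient_basis_le_card P I d (b : 'I_d -> V) (J : finType)
    (phi : J -> V -> F) :
  subspace P -> quotient_basis P I b -> (forall j, linear_on P (phi j)) ->
  (forall v, P v -> (forall j, phi j v = 0) -> I v) -> (d <= #|J|)%N.
Proof.
move=> Ps [Pb bfree _] phil sep.
pose M := \matrix_(i < d, j < #|J|) phi (enum_val j) (b i).
rewrite leqNgt; apply/negP => dJ.
have : kermx M != 0.
  by rewrite kermx_eq0 /row_free neq_ltn (leq_ltn_trans (rank_leq_col _)).
case/rowV0Pn => u /sub_kermxP uM0 /eqP[]; apply/rowP => i; rewrite mxE.
have Pu : P (\sum_i u 0 i *: b i).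
  by apply: subspace_sum => // k; apply: subspaceZ.
move: i; apply: (bfree (u 0)); split=> //; apply: sep => // j.
rewrite (linear_on_sum _ _ (phil j)) //.
have /rowP/(_ (enum_rank j)) := uM0; rewrite !mxE => uMj; rewrite -[RHS]uMj.
by apply: eq_bigr => i _; rewrite mxE enum_rankK.
Qed.

(** The functionals psi vanish on I and form with the g a triangular matrix for
    the ranking r. In a relation modulo I among the g, the functional attached to a
    vector of maximal rank among those that occur sees only that vector. *)
Lemma quotient_basis_ge_card P I d (b : 'I_d -> V) (J : finType) (g : J -> V)
    (psi : J -> V -> F) (r : J -> nat) :
  subspace P -> subspace I -> quotient_basis P I b ->
  (forall j, P (g j)) -> (forall j, linear_on P (psi j)) ->
  (forall j v, P v -> I v -> psi j v = 0) ->
  (forall j, psi j (g j) != 0) ->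
  (forall i j, psi j (g i) != 0 -> i != j -> (r j < r i)%N) ->
  (#|J| <= d)%N.
Proof.
move=> Ps Is [Pb _ bspan] Pg psil psiI psi_diag psi_tri.
have PIs := subspaceI Ps Is.
have /choice[C CE] j := bspan _ (Pg j).
pose M := \matrix_(i < #|J|, k < d) C (enum_val i) k.
rewrite leqNgt; apply/negP => dJ.
have : kermx M != 0.
  by rewrite kermx_eq0 /row_free neq_ltn (leq_ltn_trans (rank_leq_col _)).
case/rowV0Pn => u /sub_kermxP uM0 u_neq0.
pose w j := u 0 (enum_rank j).
have [j0 wj0] : exists j, w j != 0.
  have /rV0Pn[i ui] := u_neq0; exists (enum_val i).
  by rewrite /w enum_valK.
case: (@arg_maxnP _ j0 (fun j => w j != 0) r wj0) => j wj jmax.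
have gPI : (P `&` I) (\sum_i w i *: g i).
  suff -> : \sum_i w i *: g i = \sum_i w i *: (g i - \sum_k C i k *: b k).
    by apply: subspace_sum => // i; apply: subspaceZ.
  rewrite -[LHS]subr0 -[X in _ - X]/(0 : V).
  under [RHS]eq_bigr do rewrite scalerBr.
  rewrite sumrB; congr (_ - _).
  under eq_bigr do rewrite scaler_sumr.
  rewrite exchange_big big1 //= => k _.
  under eq_bigr do rewrite scalerA.
  rewrite -scaler_suml (_ : \sum_i _ = 0) ?scale0r //.
  have /rowP/(_ k) := uM0; rewrite !mxE => uMk; rewrite -[RHS]uMk.
  rewrite (reindex _ (onW_bij _ (@enum_rank_bij J))) /=.
  by apply: eq_bigr => i _; rewrite mxE enum_rankK.
have [Pw Iw] := gPI.
have := psiI j _ Pw Iw; rewrite (linear_on_sum _ Ps (psil j)) //.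
rewrite (bigD1 j) //= big1 ?addr0 => [/eqP|i ij].
  by rewrite mulf_eq0 (negPf wj) (negPf (psi_diag j)).
have [->|wi] := eqVneq (w i) 0; first by rewrite mul0r.
have [->|psi_neq0] := eqVneq (psi j (g i)) 0; first by rewrite mulr0.
by have := leq_trans (psi_tri _ _ psi_neq0 ij) (jmax i wi); rewrite ltnn.
Qed.

(** Coordinates in a basis of the quotient separate it, which allows bounds for
    one algebra to be pulled back to another. *)
Lemma quotient_coordinates P I d (b : 'I_d -> V) :
  subspace P -> subspace I -> quotient_basis P I b ->
  exists phi : 'I_d -> V -> F, (forall j, linear_on P (phi j)) /\
    (forall v, P v -> (forall j, phi j v = 0) -> I v).
Proof.
move=> Ps Is [Pb bfree bspan]; have PIs := subspaceI Ps Is.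
have bspan' v : exists c : 'I_d -> F, P v -> (P `&` I) (v - \sum_i c i *: b i).
  have [/bspan[c ?]|?] := pselect (P v); first by exists c.
  by exists (fun=> 0).
have /choice[C CE] := bspan'; exists (fun j v => C v j); split=> [j a u v Pu Pv|].
  have Pw : P (a *: u + v) by case: Ps => _; apply.
  apply/eqP; rewrite -subr_eq0; apply/eqP; move: j.
  apply: (bfree (fun j => C (a *: u + v) j - (a * C u j + C v j))).
  have := subspaceB PIs (subspaceD PIs (subspaceZ a PIs (CE _ Pu)) (CE _ Pv))
    (CE _ Pw).
  congr ((P `&` I) _).
  under [RHS]eq_bigr do rewrite scalerBl scalerDl -scalerA.
  rewrite sumrB big_split /= -scaler_sumr scalerBr.
  set w := a *: u + v; rewrite addrACA -opprD opprB [LHS]addrC.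
  by rewrite (addrA (_ - w)) subrK.
move=> v Pv C0; have [_] := CE _ Pv.
by rewrite big1 ?subr0 // => j _; rewrite C0 scale0r.
Qed.

End QuotientBounds.

Section CodimensionBounds.
Variables (F : fieldType) (A : naAlgType F).

Lemma codim_le_card n (J : finType) (phi : J -> freeAlg F -> F) :
  (forall j, linear_on (Pn n) (phi j)) ->
  (forall f, Pn n f -> (forall j, phi j f = 0) -> Id A f) ->
  (codim A n <= #|J|)%N.
Proof.
have [b bP] := codim_basis A n.
exact: (quotient_basis_le_card (subspace_Pn F n) bP).
Qed.

Lemma codim_ge_card n (J : finType) (g : J -> freeAlg F)
    (psi : J -> freeAlg F -> F) (r : J -> nat) :
  (forall j, Pn n (g j)) -> (forall j, linear_on (Pn n) (psi j)) ->
  (forall j f, Pn n f -> Id A f -> psi j f = 0) ->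
  (forall j, psi j (g j) != 0) ->
  (forall i j, psi j (g i) != 0 -> i != j -> (r j < r i)%N) ->
  (#|J| <= codim A n)%N.
Proof.
have [b bP] := codim_basis A n.
exact: (quotient_basis_ge_card (subspace_Pn F n) (subspace_Id A) bP).
Qed.

Lemma codim_coordinates n :
  exists phi : 'I_(codim A n) -> freeAlg F -> F,
    (forall j, linear_on (Pn n) (phi j)) /\
    (forall f, Pn n f -> (forall j, phi j f = 0) -> Id A f).
Proof.
have [b bP] := codim_basis A n.
exact: (quotient_coordinates (subspace_Pn F n) (subspace_Id A) bP).
Qed.

Lemma Pn_malgU n m : multilinear n m -> Pn n (<< m >> : freeAlg F).
Proof. by move=> mP k /(fsubsetP msuppU_le); rewrite in_fset1 => /eqP->. Qed.

Lemma linext_linear_on (h : monomial -> F^o) n : linear_on (Pn n) (linext h).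
Proof. by move=> a u v _ _; rewrite linearP. Qed.

Lemma evalU (a : nat -> A) m : eval a (<< m >> : freeAlg F) = eval_monomial a m.
Proof. exact: linextU. Qed.

Lemma multilinear_lt n m i : multilinear n m -> i \in leaves m -> (i < n)%N.
Proof. by move=> /perm_mem->; rewrite mem_iota. Qed.

Lemma eq_linext_Pn (V : lmodType F) (h h' : monomial -> V) n f :
  Pn n f -> (forall m, multilinear n m -> h m = h' m) ->
  linext h f = linext h' f.
Proof.
by move=> Pf hh'; apply: eq_big_seq => m /Pf/hh'->.
Qed.

Lemma linext_comp (V W : lmodType F) (L : {linear V -> W}) (h : monomial -> V) f :
  L (linext h f) = linext (L \o h) f.
Proof. by rewrite /linext linear_sum; apply: eq_bigr => m _; rewrite linearZ. Qed.

End CodimensionBounds.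

Lemma codim_le_subId (F : fieldType) (A B : naAlgType F) n :
  (forall f, Id B f -> Id A f) -> (codim A n <= codim B n)%N.
Proof.
move=> BA; have [phi [phil phiP]] := codim_coordinates B n.
rewrite -[X in (_ <= X)%N]card_ord.
by apply: (codim_le_card phil) => f Pf /(phiP f Pf)/BA.
Qed.

(** * Multilinear polynomials and adjunction of a unit *)

Section Multilinearity.
Variables (F : fieldType) (A : naAlgType F).
Implicit Types (a : nat -> A) (m : monomial).

Definition set_var a k u : nat -> A := fun i => if i == k then u else a i.

Lemma eq_eval_monomial a a' m :
  {in leaves m, a =1 a'} -> eval_monomial a m = eval_monomial a' m.
Proof.
elim: m => [i|m1 IH1 m2 IH2] /= aa'; first by rewrite aa' ?mem_head.
by rewrite IH1 ?IH2 // => i im; apply: aa'; rewrite mem_cat im ?orbT.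
Qed.

Lemma eval_monomial_set_var_linear a k m c u v :
  uniq (leaves m) -> k \in leaves m ->
  eval_monomial (set_var a k (c *: u + v)) m =
  c *: eval_monomial (set_var a k u) m + eval_monomial (set_var a k v) m.
Proof.
have set_varN w m' : k \notin leaves m' ->
    eval_monomial (set_var a k w) m' = eval_monomial a m'.
  move=> kN; apply: eq_eval_monomial => i im; rewrite /set_var.
  by case: eqP im kN => [->->|].
elim: m => [i|m1 IH1 m2 IH2] /=.
  by move=> _; rewrite inE => /eqP->; rewrite /set_var eqxx.
rewrite cat_uniq mem_cat => /and3P[u1 /hasPn disj u2] /orP[k1|k2].
  have k2 : k \notin leaves m2 by apply/negP => /disj/=; rewrite k1.
  by rewrite IH1 // !(set_varN _ m2) // linearPl.
have k1 := disj _ k2.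
by rewrite IH2 // !(set_varN _ m1) // linearPr.
Qed.

Lemma eval_set_var_linear a k n f c u v : Pn n f -> (k < n)%N ->
  eval (set_var a k (c *: u + v)) f = c *: eval (set_var a k u) f + eval (set_var a k v) f.
Proof.
move=> Pf kn; rewrite /eval -linext_linear_fun; apply: (eq_linext_Pn Pf) => m mP.
apply: eval_monomial_set_var_linear; first by rewrite (perm_uniq mP) iota_uniq.
by rewrite (perm_mem mP) mem_iota.
Qed.

(** The arguments are moved into the spanning set B one variable at a time. *)
Lemma Id_spanning (B : set A) n f :
  (forall u, exists c v w, [/\ B v, B w & u = c *: v + w]) -> Pn n f ->
  (forall a, (forall i, B (a i)) -> eval a f = 0) -> Id A f.
Proof.
move=> Bspan Pf fB a.
have [w0 Bw0] : exists w, B w by have [_ [_ [w [_ Bw _]]]] := Bspan 0; exists w.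
suff fk k : (k <= n)%N ->
    forall a, (forall i, (k <= i)%N -> B (a i)) -> eval a f = 0.
  rewrite -(fk n (leqnn n) (fun i => if (i < n)%N then a i else w0)).
    apply: (eq_linext_Pn Pf) => m mP; apply: eq_eval_monomial => i im.
    by rewrite (multilinear_lt mP im).
  by move=> i ni; rewrite ltnNge ni.
elim: k => [_|k IHk kn] {}a aB; first by apply: fB => i; apply: aB.
have [c [v [w [Bv Bw akE]]]] := Bspan (a k).
have -> : a = set_var a k (c *: v + w).
  by apply/funext => i; rewrite /set_var; case: eqP => // ->.
have set_varB u : B u -> eval (set_var a k u) f = 0.
  move=> Bu; apply: IHk => [|i ki]; first exact: ltnW.
  by rewrite /set_var; case: eqP => // /eqP ik; apply: aB; rewrite ltn_neqAle eq_sym ik.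
by rewrite (eval_set_var_linear _ _ _ _ Pf kn) !set_varB // scaler0 addr0.
Qed.

End Multilinearity.

Lemma leaves_gt0 m : (0 < size (leaves m))%N.
Proof. by elim: m => //= m1 m1_gt0 m2 _; rewrite size_cat addn_gt0 m1_gt0. Qed.

Section Collapse.
Variable ks : seq nat.

(** Substituting the unit for the variables outside ks erases the corresponding
    leaves; the kept variables are renumbered by their rank in ks. [None] is the
    empty monomial, that is, the unit. *)
Fixpoint collapse (m : monomial) : option monomial :=
  match m with
  | Var i => if i \in ks then Some (Var (index i ks)) else None
  | Node m1 m2 =>
      match collapse m1, collapse m2 with
      | Some m1', Some m2' => Some (Node m1' m2')
      | Some m1', None => Some m1'
      | None, o => o
      end
  end.

Lemma leaves_collapse m :
  oapp leaves [::] (collapse m) =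
  [seq index i ks | i <- leaves m & i \in ks].
Proof.
elim: m => [i|m1 IH1 m2 IH2] /=; first by case: ifP.
rewrite filter_cat map_cat -{}IH1 -{}IH2.
by case: (collapse m1) (collapse m2) => [?|] [?|] //=; rewrite cats0.
Qed.

Lemma collapse_multilinear n m m' :
  uniq ks -> {subset ks <= iota 0 n} -> multilinear n m -> collapse m = Some m' ->
  multilinear (size ks) m'.
Proof.
move=> uks ksn mP cm; have := leaves_collapse m; rewrite cm /= /multilinear => ->.
have -> : iota 0 (size ks) = [seq index i ks | i <- ks].
  apply: (@eq_from_nth _ 0%N) => [|i]; rewrite size_iota ?size_map // => ik.
  by rewrite nth_iota // (nth_map 0%N) // index_uniq.
apply: perm_map; apply: uniq_perm => //.
  by rewrite filter_uniq // (perm_uniq mP) iota_uniq.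
move=> i; rewrite mem_filter (perm_mem mP) andb_idr //; exact: ksn.
Qed.

Lemma collapse_None m : collapse m = None -> {in leaves m, forall i, i \notin ks}.
Proof.
move=> cm i im; apply/negP => iks; have := leaves_collapse m; rewrite cm /=.
move=> /esym/eqP; rewrite -size_eq0 size_map size_eq0 => /eqP s0.
have : i \in [seq j <- leaves m | j \in ks] by rewrite mem_filter iks.
by rewrite s0.
Qed.

Lemma eval_monomial_collapse (F : fieldType) (A : naAlgType F) (y : nat -> A) m :
  eval_monomial (A := unitization A)
    (fun i => if i \in ks then (0, y i) else (1, 0)) m =
  if collapse m is Some m' then (0, eval_monomial (y \o nth 0%N ks) m') else (1, 0).
Proof.
elim: m => [i|m1 IH1 m2 IH2] /=.
  by case: ifP => //= iks; rewrite nth_index.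
rewrite [X in unitization_mul X _]IH1 [X in unitization_mul _ X]IH2.
case: (collapse m1) (collapse m2) => [m1'|] [m2'|] //=.
- by rewrite /unitization_mul /= mulr0 !scale0r !add0r.
- exact: unitization_mulu1.
- exact: unitization_mul1u.
- exact: unitization_mul1u.
Qed.

End Collapse.

Section UnitizationBounds.
Variables (F : fieldType) (A : naAlgType F).

Definition reduct (ks : seq nat) (f : freeAlg F) : freeAlg F :=
  linext (fun m => if collapse ks m is Some m' then << m' >> else 0) f.

Lemma reduct_Pn ks n f : uniq ks -> {subset ks <= iota 0 n} ->
  Pn n f -> Pn (size ks) (reduct ks f).
Proof.
move=> uks ksn Pf; rewrite /reduct /linext big_seq.
elim/big_ind: _ => [|u v|m /Pf mP].
- by case: (subspace_Pn F (size ks)).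
- exact: (subspaceD (subspace_Pn F _)).
- apply: (subspaceZ _ (subspace_Pn F _)).
  case cm: (collapse ks m) => [m'|]; last by case: (subspace_Pn F (size ks)).
  exact: (Pn_malgU (collapse_multilinear uks ksn mP cm)).
Qed.

(** An evaluation may be assumed to send each variable to 1 or into A. If S is
    the set of variables sent into A, the value is that of the polynomial with
    the other variables erased, a multilinear polynomial of degree #|S|. For
    empty S the value is the sum of the coefficients, whence the term 1. *)
Lemma codim_unitization_le n :
  (codim (unitization A) n <= 1 + \sum_(k < n.+1) 'C(n, k) * codim A k)%N.
Proof.
pose ks (S : {set 'I_n}) : seq nat := [seq val i | i <- enum S].
have uks S : uniq (ks S) by rewrite map_inj_uniq ?enum_uniq //; apply: val_inj.
have ksn S : {subset ks S <= iota 0 n}.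
  by move=> _ /mapP[i _ ->]; rewrite mem_iota /=.
have size_ks S : size (ks S) = #|S| by rewrite size_map -cardE.
pose phi k := projT1 (cid (codim_coordinates A k)).
have phiP k : (forall j, linear_on (Pn k) (phi k j)) /\
    (forall f, Pn k f -> (forall j, phi k j f = 0) -> Id A f).
  exact: projT2 (cid (codim_coordinates A k)).
pose J : finType := (unit + {S : {set 'I_n} & 'I_(codim A #|S|)})%type.
(* One functional for the empty set, and for each S the coordinates of degree #|S|. *)
pose psi (j : J) (f : freeAlg F) : F := match j with
  | inl _ => linext (fun=> 1 : F^o) f
  | inr (existT K i) => phi #|K| i (reduct (ks K) f)
  end.
have -> : (1 + \sum_(k < n.+1) 'C(n, k) * codim A k)%N = #|J|.
  rewrite card_sum card_unit card_tagged sumnE big_map big_enum /=; congr addn.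
  rewrite (partition_big (fun S : {set 'I_n} => inord #|S| : 'I_n.+1) predT) //=.
  apply: eq_bigr => k _; have := card_draws 'I_n k; rewrite card_ord => <-.
  rewrite -sum1dep_card big_distrl /=; apply: eq_big => [S|S /eqP].
    rewrite -val_eqE /= inordK // ltnS -[leqRHS]card_ord.
    by rewrite subset_leq_card //; apply/fintype.subsetP.
  by move=> ->; rewrite mul1n card_ord.
apply: (@codim_le_card _ _ _ J psi) => [[_|[K i]] a u v Pu Pv /=|f Pf psi0].
- by rewrite linearP.
- have [phil _] := phiP #|K|; rewrite /reduct linearP -!/(reduct _ _) phil //.
    by rewrite -size_ks; apply: reduct_Pn.
  by rewrite -size_ks; apply: reduct_Pn.
pose B : set (unitization A) := [set u | u = (1, 0) \/ u.1 = 0].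
apply: (@Id_spanning _ (unitization A) B n) => // [[c x]|a a1].
  exists c, (1, 0), (0, x); split; [by left|by right|].
  congr (_, _) => /=; last by rewrite scaler0 add0r.
  by rewrite addr0 [RHS]mulr1.
pose S : {set 'I_n} := [set i : 'I_n | (a i).1 == 0]%SET.
have inS i : (i < n)%N -> (i \in ks S) = ((a i).1 == 0).
  move=> lt_in; apply/mapP/idP => [[j]|ai0].
    by rewrite mem_enum inE => aj0 ->.
  by exists (Ordinal lt_in) => //; rewrite mem_enum inE.
have -> : eval a f = eval (A := unitization A)
    (fun i => if i \in ks S then (0, (a i).2) else (1, 0)) f.
  apply: (eq_linext_Pn Pf) => m mP; apply: eq_eval_monomial => i im.
  rewrite (inS _ (multilinear_lt mP im)).
  by case: (a i) (a1 i) => c x [[-> ->]|/= ->] /=; rewrite ?oner_eq0 ?eqxx.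
have fS : Id A (reduct (ks S) f).
  have [_] := phiP #|S|; apply; first by rewrite -size_ks; apply: reduct_Pn.
  by move=> j; apply: (psi0 (inr (Tagged _ j))).
pose h m : unitization A := if collapse (ks S) m is Some m' then
  (0, eval_monomial ((fun i => (a i).2) \o nth 0%N (ks S)) m') else (1, 0).
rewrite /eval (eq_linext_Pn (h' := h) Pf); last first.
  by move=> m _; apply: eval_monomial_collapse.
apply/eqP; rewrite -pair_eqE /=; apply/andP; split; apply/eqP.
  have -> : (linext h f).1 = linext (fun m => (h m).1) f.
    exact: (linext_comp (@fst F^o A)).
  have [S0|[i iS]] := set_0Vmem S.
    rewrite -[RHS](psi0 (inl tt)) /=; apply: (eq_linext_Pn Pf) => m mP.
    have := leaves_collapse (ks S) m; rewrite /h /ks S0 enum_set0 /=.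
    rewrite filter_pred0; case: collapse => //= m' /eqP.
    by rewrite -size_eq0 eqn0Ngt leaves_gt0.
  rewrite /linext big_seq big1 // => m /Pf mP; rewrite /h.
  case cm: (collapse _ _) => [//|]; first by rewrite scaler0.
  have /negP[] : (i : nat) \notin ks S.
    by apply: (collapse_None cm); rewrite (perm_mem mP) mem_iota /=.
  by apply: map_f; rewrite mem_enum.
have -> : (linext h f).2 = linext (fun m => (h m).2) f.
  exact: (linext_comp (@snd F^o A)).
rewrite -[RHS](fS ((fun i => (a i).2) \o nth 0%N (ks S))) /eval /reduct.
rewrite linext_comp; apply: (eq_linext_Pn Pf) => m _; rewrite /h /=.
by case: collapse => [m'|]; rewrite ?linextU ?linear0.
Qed.

End UnitizationBounds.

Lemma eval_monomial_embed (F : fieldType) (A : naAlgType F) (y : nat -> A) m :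
  eval_monomial (A := unitization A) (fun i => (0, y i)) m =
  (0, eval_monomial y m).
Proof.
elim: m => [//|m1 IH1 m2 IH2] /=.
rewrite [X in unitization_mul X _]IH1 [X in unitization_mul _ X]IH2.
by rewrite /unitization_mul /= mulr0 !scale0r !add0r.
Qed.

Lemma codim_le_unitization (F : fieldType) (A : naAlgType F) n :
  (codim A n <= codim (unitization A) n)%N.
Proof.
apply: codim_le_subId => f fId a.
rewrite -[RHS](congr1 snd (fId (fun i => (0, a i)))) /eval.
rewrite (linext_comp (@snd F^o A)).
by congr linext; apply/funext => m /=; rewrite eval_monomial_embed.
Qed.

Definition lmon i (s : seq nat) : monomial :=
  foldl (fun m j => Node m (Var j)) (Var i) s.

Lemma lmon_rcons i s j : lmon i (rcons s j) = Node (lmon i s) (Var j).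
Proof. by rewrite /lmon -cats1 foldl_cat. Qed.

Lemma leaves_lmon i s : leaves (lmon i s) = i :: s.
Proof.
by elim/last_ind: s => //= s j IHs; rewrite lmon_rcons /= IHs cats1.
Qed.

Lemma eval_lmon_unitization (F : fieldType) (A : naAlgType F) (p : pred nat)
    (y : nat -> A) i s : p i ->
  eval_monomial (A := unitization A) (fun j => if p j then (0, y j) else (1, 0))
    (lmon i s) = (0, eval_monomial y (lmon i (seq.filter p s))).
Proof.
move=> pi; elim/last_ind: s => [|s j IHs] /=; first by rewrite pi.
rewrite lmon_rcons /= [X in unitization_mul X _]IHs filter_rcons.
case: (p j); last exact: unitization_mulu1.
by rewrite lmon_rcons /unitization_mul /= mulr0 !scale0r !add0r.
Qed.

(** * The track algebra *)

(* Stated for abstract summands: on the concrete spaces used below, unfolding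
   the operations is far too slow. *)
Lemma pair_lin1 (R : pzRingType) (U V : lmodType R) (a : R) (u v : (U * V)%type) :
  (a *: u + v).1 = a *: u.1 + v.1.
Proof. by []. Qed.

Lemma pair_lin2 (R : pzRingType) (U V : lmodType R) (a : R) (u v : (U * V)%type) :
  (a *: u + v).2 = a *: u.2 + v.2.
Proof. by []. Qed.

Lemma fct_lin (R : pzRingType) (T : Type) (U : lmodType R) (a : R)
    (u v : T -> U) x :
  (a *: u + v) x = a *: u x + v x.
Proof. by []. Qed.

Section Tracks.
Variables (F : fieldType) (per len : nat -> nat).

Definition letter i t : nat := if (per i %| t)%N then t else 0%N.

(** Arbitrary functions rather than finitely supported ones: the product is
    given coordinatewise, so no basis is needed. *)
Definition track : lmodType F := ((nat -> nat -> F^o) * (nat -> F^o))%type.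

Lemma track_lin1 a (u v : track) i t :
  (a *: u + v).1 i t = a * u.1 i t + v.1 i t.
Proof. by rewrite pair_lin1 !fct_lin. Qed.

Lemma track_lin2 a (u v : track) l : (a *: u + v).2 l = a * u.2 l + v.2 l.
Proof. by rewrite pair_lin2 !fct_lin. Qed.

Lemma track_eq (u v : track) :
  (forall i t, u.1 i t = v.1 i t) -> (forall l, u.2 l = v.2 l) -> u = v.
Proof.
case: u v => [u1 u2] [v1 v2] /= uv1 uv2; congr (_, _); last exact/funext.
by apply/funext => i; apply/funext => t.
Qed.

Definition track_mul (u v : track) : track :=
  ((fun i t => if t is t'.+1 then
      if (t < len i)%N then u.1 i t' * v.2 (letter i t) else 0 else 0),
   fun=> 0).

Lemma track_mul1S u v i t : (track_mul u v).1 i t.+1 =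
  if (t.+1 < len i)%N then u.1 i t * v.2 (letter i t.+1) else 0.
Proof. by []. Qed.

Lemma track_mul_bilinear : bilinear_for *:%R *:%R track_mul.
Proof.
split=> [v|u] a x y; apply: track_eq => [i [|t]|l].
- by rewrite track_lin1 mulr0 addr0.
- rewrite track_lin1 !track_mul1S; case: ifP => _; last by rewrite mulr0 addr0.
  by rewrite track_lin1 mulrDl mulrA.
- by rewrite track_lin2 mulr0 addr0.
- by rewrite track_lin1 mulr0 addr0.
- rewrite track_lin1 !track_mul1S; case: ifP => _; last by rewrite mulr0 addr0.
  by rewrite track_lin2 mulrDr mulrCA.
- by rewrite track_lin2 mulr0 addr0.
Qed.

HB.instance Definition _ :=
  bilinear_isBilinear.Build F track track track *:%R *:%R track_mul
    track_mul_bilinear.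

Definition trackAlg : naAlgType F := @NaAlg F track track_mul.


Implicit Types (a : nat -> trackAlg) (m : monomial).

Lemma eval_lmon_lt a x s i t : (t < size s)%N ->
  (eval_monomial a (lmon x s)).1 i t = 0.
Proof.
elim/last_ind: s t => [|s y IHs] [|t] //; rewrite lmon_rcons //= size_rcons ltnS.
by move=> ts; case: ifP => // _; rewrite IHs // mul0r.
Qed.

Lemma eval_lmon_ge a x s i t : s != [::] -> (len i <= t)%N ->
  (eval_monomial a (lmon x s)).1 i t = 0.
Proof.
elim/last_ind: s t => [//|s y _] [|t] _ lt; rewrite lmon_rcons //=.
by rewrite ltnNge lt.
Qed.

Lemma eval_lmon a x s i j : (j + size s < len i)%N ->
  (eval_monomial a (lmon x s)).1 i (j + size s)%N =
  (a x).1 i j * \prod_(k <- iota 1 (size s)) (a (nth 0%N (x :: s) k)).2 (letter i (j + k)).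
Proof.
elim/last_ind: s => [|s y IHs]; first by rewrite addn0 /= big_nil mulr1.
rewrite size_rcons addnS lmon_rcons => lt; rewrite [LHS]/= lt IHs; last exact: ltnW.
have -> : iota 1 (size s).+1 = iota 1 (size s) ++ [:: (size s).+1].
  by rewrite -{1}[(size s).+1]addn1 iotaD.
rewrite big_cat /= big_seq1 mulrA addnS; congr (_ * _ * _).
  apply: eq_big_seq => k; rewrite mem_iota add1n => /andP[k0 ks].
  by case: k k0 ks => //= k _ ks; rewrite nth_rcons -ltnS ks.
by rewrite /= nth_rcons ltnn eqxx.
Qed.

Definition left_normed m : bool := m == lmon (head 0%N (leaves m)) (behead (leaves m)).

(** A product has no letter part, so it annihilates anything on its left. *)
Lemma eval_not_left_normed a m : ~~ left_normed m -> eval_monomial a m = 0.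
Proof.
have Node0 (u v : trackAlg) : u = 0 \/ v.2 = 0 -> track_mul u v = 0.
  move=> uv; congr (_, _); apply/funext => i; apply/funext => -[|t] //=.
  by case: ifP => // _; case: uv => [->|->]; rewrite ?mul0r ?mulr0.
elim: m => [i|m1 IH1 m2 IH2]; first by rewrite /left_normed eqxx.
case: m2 IH2 => [j _|m3 m4 _] /= nln; apply: Node0; [left|by right].
apply: IH1; apply: contra nln => /eqP m1E; rewrite /left_normed /= cats1.
by rewrite m1E leaves_lmon /= lmon_rcons.
Qed.


Definition word_coord a i t (s : seq nat) : F :=
  (eval_monomial a (lmon (head 0%N s) (behead s))).1 i t.

Lemma perm_eq_nth_lt n s k : perm_eq s (iota 0 n) -> (k < n)%N -> (nth 0%N s k < n)%N.
Proof.
move=> sn kn; have /perm_mem E := sn.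
have : nth 0%N s k \in s by rewrite mem_nth // (perm_size sn) size_iota.
by rewrite E mem_iota.
Qed.

(** At a position carrying the common letter, the variable only contributes its
    coefficient at that letter, and the product of these contributions does not
    depend on their order. So the value of a monomial depends only on its first
    variable and on the variables at the special positions. *)
Lemma eq_word_coord a i t n s s' :
  perm_eq s (iota 0 n) -> perm_eq s' (iota 0 n) ->
  nth 0%N s 0 = nth 0%N s' 0 ->
  (forall k, (0 < k < n)%N -> (per i %| (t - n.-1) + k)%N ->
    nth 0%N s k = nth 0%N s' k) ->
  word_coord a i t s = word_coord a i t s'.
Proof.
case: n => [|n]; first by move=> /perm_nilP -> /perm_nilP ->.
case: s => [/perm_size//|x s] sP; case: s' => [/perm_size//|x' s'] s'P /=.
move=> xx' spec; rewrite -{x'}xx' in s'P spec *.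
have [/= [sn] [s'n]] := (perm_size sP, perm_size s'P); rewrite size_iota in sn s'n.
rewrite /word_coord /=; have [tn|nt] := ltnP t n.
  by rewrite !eval_lmon_lt ?sn ?s'n.
have [n0|n_gt0] := posnP n.
  by move/eqP: sn; move/eqP: s'n; rewrite n0 !size_eq0 => /eqP-> /eqP->.
have [lt|tl] := leqP (len i) t.
  by rewrite !eval_lmon_ge // -size_eq0 ?sn ?s'n -lt0n.
set j := (t - n)%N in spec *.
have evalE w : size w = n -> (eval_monomial a (lmon x w)).1 i t = (a x).1 i j *
    \prod_(k <- iota 1 n) (a (nth 0%N (x :: w) k)).2 (letter i (j + k)).
  move=> wn; have tE : t = (j + size w)%N by rewrite wn subnK.
  by rewrite {1}tE eval_lmon -?tE // wn.
rewrite !evalE //; congr (_ * _).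
pose spc k := (per i %| j + k)%N.
pose get (w : seq nat) k := nth 0%N (x :: w) k.
have getE w : size w = n -> map (get w) (iota 1 n) = w.
  move=> wn; apply: (@eq_from_nth _ 0%N); rewrite size_map size_iota // => k kn.
  by rewrite (nth_map 0%N) ?size_iota // nth_iota // add1n.
have spcE : {in [seq k <- iota 1 n | spc k], get s =1 get s'}.
  move=> k; rewrite mem_filter mem_iota => /andP[spk /andP[k0 kn]].
  by apply: spec => //; rewrite k0.
have perm_nspc : perm_eq [seq get s k | k <- iota 1 n & ~~ spc k]
                         [seq get s' k | k <- iota 1 n & ~~ spc k].
  have split w : perm_eq (map (get w) (iota 1 n))
      ([seq get w k | k <- iota 1 n & spc k] ++
       [seq get w k | k <- iota 1 n & ~~ spc k]).
    by rewrite -map_cat perm_map // perm_sym; exact: (permEl (perm_filterC spc _)).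
  have : perm_eq (map (get s) (iota 1 n)) (map (get s') (iota 1 n)).
    rewrite !getE //; have : perm_eq (x :: s) (x :: s').
      by apply: perm_trans sP _; rewrite perm_sym.
    by rewrite perm_cons.
  rewrite (permPl (split s)) (permPr (split s')).
  have /eq_in_map-> := spcE.
  by rewrite perm_cat2l.
rewrite (bigID spc) [RHS](bigID spc) /=; congr (_ * _).
  rewrite -big_filter -[RHS]big_filter; apply: eq_big_seq => k /spcE.
  by rewrite /get => ->.
have nspcE w : \prod_(k <- iota 1 n | ~~ spc k)
    (a (nth 0%N (x :: w) k)).2 (letter i (j + k)) =
    \prod_(y <- [seq get w k | k <- iota 1 n & ~~ spc k]) (a y).2 0%N.
  rewrite big_map big_filter; apply: eq_bigr => k nspk.
  by rewrite /letter -/(spc k) (negPf nspk).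
by rewrite !nspcE; apply: perm_big.
Qed.

Definition track_coord i t (u : trackAlg) : F^o := u.1 i t.

Lemma track_coord_is_linear i t : linear (track_coord i t).
Proof. by move=> a u v; rewrite /track_coord track_lin1. Qed.

HB.instance Definition _ i t :=
  GRing.isLinear.Build F trackAlg F^o *:%R (track_coord i t) (track_coord_is_linear i t).

Definition key_sum (T : eqType) (K : seq nat -> T) (x : T) (f : freeAlg F) : F :=
  linext (fun m => (left_normed m && (K (leaves m) == x))%:R : F^o) f.

(** Grouping the monomials by the value of the key K on which their evaluation
    depends, the evaluation of f becomes a combination of the sums [key_sum]. *)
Lemma eval_keys (T : finType) (K : seq nat -> T) a i t n f : Pn n f ->
  (forall s s', perm_eq s (iota 0 n) -> perm_eq s' (iota 0 n) -> K s = K s' ->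
    word_coord a i t s = word_coord a i t s') ->
  (forall x, key_sum K x f = 0) -> (eval a f).1 i t = 0.
Proof.
move=> Pf Kcoord f0.
(* g x is the common value of the words with key x, arbitrary if there are none. *)
pose g x := word_coord a i t (xget [::] [set s | perm_eq s (iota 0 n) /\ K s = x]).
transitivity (\sum_x g x * key_sum K x f); last first.
  by rewrite big1 // => x _; rewrite f0 mulr0.
rewrite -[LHS]/(track_coord i t (eval a f)) /eval linext_comp.
transitivity (linext (fun m => \sum_x
    g x *: ((left_normed m && (K (leaves m) == x))%:R : F^o)) f); last first.
  rewrite /linext; under eq_bigr do rewrite scaler_sumr.
  rewrite exchange_big; apply: eq_bigr => x _ /=; rewrite /key_sum /linext.
  by rewrite mulr_sumr; apply: eq_bigr => m _; rewrite !scalerA mulrC -scalerA.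
apply: (eq_linext_Pn Pf) => m mP /=; have [nln|nnl] := boolP (left_normed m); last first.
  rewrite eval_not_left_normed // linear0 big1 // => x _; by rewrite scaler0.
rewrite (bigD1 (K (leaves m))) //= eqxx big1 => [|x]; last first.
  by rewrite eq_sym => /negPf->; rewrite scaler0.
rewrite addr0 [RHS]mulr1 /g /track_coord.
case: xgetP => [s _ [sP sK]|/(_ (leaves m))[]]; last by [].
by rewrite (Kcoord s _ sP mP sK) /word_coord -(eqP nln).
Qed.

End Tracks.

(** * Upper bounds for the codimensions of the track algebra *)

Lemma codim0 (F : fieldType) (A : naAlgType F) : codim A 0 = 0%N.
Proof.
apply/eqP; rewrite -leqn0 -[leqRHS]card_void.
apply: (@codim_le_card _ _ _ void (fun _ _ => 0)) => [[]|f Pf _ a].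
rewrite /eval (eq_linext_Pn (h' := fun=> 0) Pf) => [|m mP].
  by rewrite /linext big1 // => m _; rewrite scaler0.
by have := leaves_gt0 m; rewrite (perm_size mP).
Qed.

Lemma codim1_le1 (F : fieldType) (A : naAlgType F) : (codim A 1 <= 1)%N.
Proof.
rewrite -[leqRHS]card_unit.
pose phi (_ : unit) (f : freeAlg F) : F := linext (fun=> 1 : F^o) f.
apply: (codim_le_card (phi := phi)) => [j|f Pf /(_ tt) f0 a].
  exact: linext_linear_on.
rewrite /eval (eq_linext_Pn (h' := fun=> a 0%N) Pf) => [|m mP].
  have := congr1 ( *:%R^~ (a 0%N)) f0; rewrite scale0r => <-.
  rewrite /phi /linext scaler_suml; apply: eq_bigr => m _.
  by rewrite [f@_m *: 1]mulr1.
have := perm_size mP; case: m mP => [i mP _|m1 m2 _] /=.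
  by have := perm_mem mP 0%N; rewrite !inE => /eqP <-.
rewrite size_cat; have := leaves_gt0 m1; have := leaves_gt0 m2.
by case: (size _) => // ? _; case: (size _) => // ? _; rewrite addnS.
Qed.

Section TrackUpperBounds.
Variables (F : fieldType) (per len : nat -> nat).
Local Notation A := (trackAlg F per len).

Lemma eval_snd n f (a : nat -> A) : (1 < n)%N -> Pn n f -> (eval a f).2 = 0.
Proof.
move=> n_gt1 Pf; rewrite /eval (linext_comp (@snd _ (nat -> F^o))).
rewrite (eq_linext_Pn (h' := fun=> 0) Pf) => [|m mP].
  by rewrite /linext big1 // => m _; rewrite scaler0.
case: m mP => [i mP|m1 m2 _] //.
by have := perm_size mP; rewrite size_iota => n1; rewrite -n1 in n_gt1.
Qed.

(** For a window with at most one special position k; k = 0, the position of the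
    first variable, stands for a window without special letter. *)
Definition sparse_key n (k : 'I_n.+1) (s : seq nat) : 'I_n.+1 * 'I_n.+1 :=
  (inord (nth 0%N s 0), inord (nth 0%N s k)).

(** For a window whose special positions are those congruent to r modulo p.
    Slot 0 records the first variable and slot l + 1 the variable at position
    r + l p; slots beyond the window hold the default value of [nth]. *)
Definition dense_key n p (r : 'I_p) (s : seq nat) :
    {ffun 'I_(n.+1 %/ p + 2) -> 'I_n.+1} :=
  [ffun l : 'I__ => inord (nth 0%N s (if val l is l'.+1 then r + l' * p else 0))].

Lemma inord_nth_inj n s s' k : perm_eq s (iota 0 n.+1) ->
  perm_eq s' (iota 0 n.+1) -> (k <= n)%N ->
  (inord (nth 0%N s k) : 'I_n.+1) = inord (nth 0%N s' k) ->
  nth 0%N s k = nth 0%N s' k.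
Proof.
move=> sP s'P kn /(congr1 val) /=.
by rewrite !inordK //; apply: (@perm_eq_nth_lt n.+1).
Qed.

Lemma eval_sparse_keys n f (a : nat -> A) i t : Pn n.+1 f ->
  (forall k x, key_sum (@sparse_key n k) x f = 0) ->
  (n < per i)%N || (len i <= n)%N -> (0 < n)%N -> (eval a f).1 i t = 0.
Proof.
move=> Pf f0 /orP[n_per|len_n] n_gt0; last first.
  apply: (eval_keys (K := sparse_key ord0) Pf) => [s s' sP s'P _|x]; last exact: f0.
  have word0 w : perm_eq w (iota 0 n.+1) -> word_coord a i t w = 0.
    move=> /perm_size; rewrite size_iota; case: w => //= x w [wn].
    rewrite /word_coord /=; have [tn|nt] := ltnP t n.
      by rewrite eval_lmon_lt ?wn.
    rewrite eval_lmon_ge ?(leq_trans len_n) //.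
    by rewrite -size_eq0 wn -lt0n.
  by rewrite !word0.
have [k kP] : exists k : 'I_n.+1, forall k', (0 < k' < n.+1)%N ->
    (per i %| (t - n) + k')%N -> k' = k :> nat.
  have [[k /andP[/andP[k0 kn] kper]]|none] := pselect (exists k,
      (0 < k < n.+1)%N && (per i %| (t - n) + k)%N); last first.
    by exists ord0 => k' k'n k'per; case: none; exists k'; rewrite k'n.
  exists (Ordinal kn) => k' /andP[k'0 k'n] k'per /=.
  have kk' : (t - n + k' = t - n + k %[mod per i])%N.
    by move: k'per kper; rewrite /dvdn => /eqP-> /eqP->.
  move/eqP: kk'; rewrite eqn_modDl !modn_small => [/eqP//||].
    exact: leq_trans n_per.
  exact: leq_trans n_per.
apply: (eval_keys (K := sparse_key k) Pf) => [s s' sP s'P [s0 sk]|x]; last exact: f0.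
apply: (eq_word_coord _ sP s'P); first exact: (inord_nth_inj sP s'P _ s0).
move=> k' k'n /(kP _ k'n) ->.
by apply: (inord_nth_inj sP s'P _ sk); rewrite -ltnS.
Qed.

Lemma eval_dense_keys n f (a : nat -> A) i t : Pn n.+1 f -> (0 < per i)%N ->
  (forall r x, key_sum (@dense_key n (per i) r) x f = 0) -> (eval a f).1 i t = 0.
Proof.
set p := per i => Pf p_gt0 f0; set j := (t - n)%N.
pose r : 'I_p := Ordinal (ltn_pmod (p - j %% p) p_gt0).
have pjr : (p %| j + r)%N.
  by rewrite /dvdn modnDmr -modnDml subnKC ?modnn // ltnW ?ltn_pmod.
apply: (eval_keys (K := dense_key n r) Pf) => [s s' sP s'P /ffunP keyE|x]; last exact: f0.
apply: (eq_word_coord _ sP s'P) => [|k /andP[k0 kn] pjk].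
  have zlt : (0 < n.+1 %/ p + 2)%N by rewrite addn2.
  have := keyE (Ordinal zlt).
  by rewrite !ffunE => /(inord_nth_inj sP s'P); apply.
have kE : k = (r + k %/ p * p)%N.
  rewrite addnC {1}(divn_eq k p); congr addn.
  have : (j + k == j + r %[mod p])%N.
    by move: pjk pjr; rewrite /dvdn => /eqP-> /eqP->.
  by rewrite eqn_modDl (modn_small (ltn_ord r)) => /eqP.
have llt : ((k %/ p).+1 < n.+1 %/ p + 2)%N.
  by rewrite addn2 !ltnS leq_div2r // ltnW.
have := keyE (Ordinal llt); rewrite !ffunE /= -kE.
by apply: inord_nth_inj.
Qed.

(** The cube counts the keys: a position and two variables. *)
Lemma codim_track_le_cube n : (1 < n)%N ->
  (forall i, (n <= per i)%N || (len i < n)%N) -> (codim A n <= n ^ 3)%N.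
Proof.
case: n => // n; rewrite ltnS => n_gt0 sparse_off.
pose phi (j : 'I_n.+1 * ('I_n.+1 * 'I_n.+1)) := key_sum (F := F) (sparse_key j.1) j.2.
have <- : #|{: 'I_n.+1 * ('I_n.+1 * 'I_n.+1)}| = (n.+1 ^ 3)%N.
  by rewrite !card_prod !card_ord.
apply: (codim_le_card (phi := phi)) => [j|f Pf f0 a]; first exact: linext_linear_on.
apply/eqP; rewrite -pair_eqE /= (eval_snd _ _ Pf) // eqxx andbT; apply/eqP.
apply/funext => i; apply/funext => t; apply: (eval_sparse_keys _ _ Pf) => //.
by move=> k x; apply: (f0 (k, x)).
Qed.

(** The second summand counts the keys of the single track i0 that can show
    several special letters in a window of length n. *)
Lemma codim_track_le_dense n i0 : (1 < n)%N -> (0 < per i0)%N ->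
  (forall i, i != i0 -> (n <= per i)%N || (len i < n)%N) ->
  (codim A n <= n ^ 3 + per i0 * n ^ (n %/ per i0 + 2))%N.
Proof.
case: n => // n; rewrite ltnS => n_gt0 p_gt0 sparse_off; set p := per i0 in p_gt0 *.
pose J1 : finType := ('I_n.+1 * ('I_n.+1 * 'I_n.+1))%type.
pose J2 : finType := ('I_p * {ffun 'I_(n.+1 %/ p + 2) -> 'I_n.+1})%type.
pose phi (j : J1 + J2) : freeAlg F -> F := match j with
  | inl j => key_sum (sparse_key j.1) j.2
  | inr j => key_sum (dense_key n j.1) j.2
  end.
have -> : (n.+1 ^ 3 + p * n.+1 ^ (n.+1 %/ p + 2))%N = #|{: J1 + J2}|.
  by rewrite card_sum !card_prod card_ffun !card_ord.
apply: (codim_le_card (phi := phi)) => [[]j|f Pf f0 a].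
- exact: linext_linear_on.
- exact: linext_linear_on.
apply/eqP; rewrite -pair_eqE /= (eval_snd _ _ Pf) // eqxx andbT; apply/eqP.
apply/funext => i; apply/funext => t; have [->|ii0] := eqVneq i i0.
  by apply: (eval_dense_keys _ _ Pf) => // r x; apply: (f0 (inr (r, x))).
apply: (eval_sparse_keys _ _ Pf) => // [k x|]; last exact: sparse_off.
exact: (f0 (inl (k, x))).
Qed.

End TrackUpperBounds.

(** * Lower bounds for the codimensions of the track algebra *)

Lemma perm_complete_iota n s : uniq s -> {subset s <= iota 1 n} ->
  perm_eq (s ++ [seq x <- iota 1 n | x \notin s]) (iota 1 n).
Proof.
move=> us sn; apply: uniq_perm; last 1 first.
- move=> x; rewrite mem_cat mem_filter; case: (boolP (x \in s)) => //= xs.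
  by rewrite sn.
- rewrite cat_uniq us filter_uniq ?iota_uniq // andbT /=.
  by apply/hasPn => x; rewrite mem_filter => /andP[].
- exact: iota_uniq.
Qed.

Section TrackLowerBounds.
Variables (F : fieldType) (per len : nat -> nat).
Local Notation A := (trackAlg F per len).

Definition start i j : A := ((fun i' t => ((i' == i) && (t == j))%:R), fun=> 0).

Definition step l : A := ((fun _ _ => 0), fun l' => (l' == l)%:R).

Lemma eval_lmon_start (a : nat -> A) x s i j :
  a x = start i j -> (j + size s < len i)%N ->
  (eval_monomial a (lmon x s)).1 i (j + size s)%N =
  \prod_(k <- iota 1 (size s)) (a (nth 0%N (x :: s) k)).2 (letter per i (j + k)).
Proof. by move=> ax lt; rewrite eval_lmon // ax /= !eqxx mul1r. Qed.

(** Each injection t of the special positions into the variables is completed to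
    a left-normed monomial. Evaluating the variable t(k) at the letter k and the
    variables outside the image at the common letter is nonzero on the monomial
    of t only, so the monomials are independent. *)
Lemma codim_track_ge i n : (0 < per i)%N -> (n < len i)%N ->
  (n ^_ (n %/ per i) <= codim A n.+1)%N.
Proof.
set p := per i => p_gt0 n_len; set q := (n %/ p)%N.
pose J := {t : q.-tuple 'I_n | uniq t}.
have <- : #|{: J}| = (n ^_ q)%N.
  have := card_uniq_tuples q 'I_n; rewrite card_ord => <-.
  rewrite card_sig; apply: eq_card => t; rewrite !inE.
  suff -> : all 'I_n t by []. exact/allP.
pose Q := [seq (p * l.+1)%N | l <- iota 0 q].
pose vt (t : J) := [seq (val x).+1 | x <- val t].
(* The k-th variable of the word has in compl (vt t) the rank of k in compl Q:
   special positions receive the entries of t, the others the unused variables. *)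
pose compl s := s ++ [seq x <- iota 1 n | x \notin s].
pose w t := [seq nth 0%N (compl (vt t)) (index k (compl Q)) | k <- iota 1 n].
have uQ : uniq Q.
  rewrite map_inj_uniq ?iota_uniq // => x y /eqP.
  by rewrite eqn_pmul2l // => /eqP[].
have QP k : k \in iota 1 n -> (k \in Q) = (p %| k)%N.
  rewrite mem_iota add1n ltnS => /andP[k0 kn]; apply/mapP/idP => [[l _ ->]|pk].
    exact: dvdn_mulr.
  have kp : (0 < k %/ p)%N by rewrite divn_gt0 // dvdn_leq.
  exists (k %/ p).-1; last by rewrite prednK // mulnC divnK.
  rewrite mem_iota /= add0n prednK //; exact: leq_div2r.
have Qn : {subset Q <= iota 1 n}.
  move=> _ /mapP[l + ->]; rewrite !mem_iota /= add1n ltnS add0n => lq.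
  rewrite muln_gt0 p_gt0 /= mulnC; apply: leq_trans (leq_trunc_div n p).
  by rewrite leq_pmul2r.
have uvt t : uniq (vt t).
  by rewrite map_inj_uniq ?(valP t) // => x y [] /val_inj.
have vtn t : {subset vt t <= iota 1 n}.
  by move=> _ /mapP[x _ ->]; rewrite mem_iota add1n ltnS; apply: (ltn_ord x).
have szQ : size Q = q by rewrite size_map size_iota.
have szvt t : size (vt t) = q by rewrite size_map size_tuple.
have complP s : uniq s -> {subset s <= iota 1 n} -> perm_eq (compl s) (iota 1 n).
  exact: perm_complete_iota.
have QC := complP _ uQ Qn; have vtC t := complP _ (uvt t) (vtn t).
have wP t : perm_eq (w t) (iota 1 n).
  apply: perm_trans (vtC t).
  rewrite perm_sym in QC; apply: perm_trans (perm_map _ QC) _.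
  rewrite perm_sym in QC.
  suff -> : [seq nth 0%N (compl (vt t)) (index k (compl Q)) | k <- compl Q] =
    compl (vt t) by [].
  have uC : uniq (compl Q) by rewrite (perm_uniq QC) iota_uniq.
  apply: (@eq_from_nth _ 0%N) => [|k]; rewrite size_map.
    by rewrite (perm_size QC) (perm_size (vtC t)).
  by move=> kn; rewrite (nth_map 0%N) // index_uniq.
have nth_w t k : k \in iota 1 n ->
    nth 0%N (0%N :: w t) k = nth 0%N (compl (vt t)) (index k (compl Q)).
  rewrite mem_iota add1n ltnS => /andP[]; case: k => // k _ kn /=.
  by rewrite (nth_map 0%N) ?size_iota // nth_iota // add1n.
have nth_wQ t k : k \in Q -> nth 0%N (0%N :: w t) k = nth 0%N (vt t) (index k Q).
  move=> kQ; rewrite nth_w; last exact: Qn.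
  by rewrite /compl index_cat kQ nth_cat szvt -szQ index_mem kQ.
pose a t x : A := if x == 0%N then start i 0 else
  if x \in vt t then step (nth 0%N Q (index x (vt t))) else step 0.
pose psi t f := track_coord i n (eval (a t) f).
pose g t : freeAlg F := << lmon 0 (w t) >>.
have szw t : size (w t) = n by rewrite size_map size_iota.
have psi_g t t' : psi t (g t') = \prod_(k <- iota 1 n)
    (a t (nth 0%N (0%N :: w t') k)).2 (letter per i k).
  rewrite /psi /track_coord evalU -{1}(szw t') -[size (w t')]add0n.
  by rewrite eval_lmon_start // ?szw.
apply: (codim_ge_card (g := g) (psi := psi) (r := fun=> 0%N)).
- move=> t; apply: Pn_malgU; rewrite /multilinear leaves_lmon /= perm_cons.
  exact: wP.
- by move=> t c u v _ _; rewrite /psi /eval !linearP.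
- by move=> t f _ fId; rewrite /psi fId linear0.
- move=> t; rewrite psi_g big_seq prodf_seq_neq0; apply/allP => k kn /=.
  apply/implyP => _; have [kQ|kNQ] := boolP (k \in Q).
    rewrite nth_wQ // /a; set x := nth _ _ _.
    have kq : (index k Q < size (vt t))%N by rewrite szvt -szQ index_mem.
    have xvt : x \in vt t by apply: mem_nth.
    have /negPf-> : x != 0%N by have := vtn _ _ xvt; rewrite mem_iota; case: x {xvt}.
    rewrite xvt index_uniq // nth_index // /letter -QP // kQ /= eqxx.
    exact: oner_neq0.
  rewrite nth_w // /a; set x := nth _ _ _.
  have : x \in [seq x <- iota 1 n | x \notin vt t].
    rewrite /x /compl index_cat (negPf kNQ) szQ nth_cat szvt ltnNge leq_addr /=.
    rewrite addKn mem_nth //; have := perm_size (vtC t); rewrite -(perm_size QC).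
    rewrite !size_cat szvt szQ => /addnI->; rewrite index_mem mem_filter kNQ.
    exact: kn.
  rewrite mem_filter => /andP[xvt xn].
  have /negPf-> : x != 0%N by have := xn; rewrite mem_iota; case: x {xn xvt}.
  rewrite (negPf xvt) /letter -QP // (negPf kNQ) /=; exact: oner_neq0.
- move=> t' t; rewrite psi_g big_seq prodf_seq_neq0 => /allP nz /eqP[].
  apply/esym/val_inj/val_inj/(@inj_map _ _ (fun x : 'I_n => (val x).+1)).
    by move=> x y [] /val_inj.
  rewrite -/(vt t) -/(vt t'); apply: (@eq_from_nth _ 0%N); rewrite !szvt //.
  move=> l lq; pose k := nth 0%N Q l.
  have kQ : k \in Q by apply: mem_nth; rewrite szQ.
  have := nz k (Qn _ kQ); rewrite Qn //= nth_wQ // /k index_uniq ?szQ // -/k.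
  set x := nth 0%N (vt t') l.
  have xvt' : x \in vt t' by apply: mem_nth; rewrite szvt.
  rewrite /a; have /negPf-> : x != 0%N.
    by have := vtn _ _ xvt'; rewrite mem_iota; case: x {xvt'}.
  have := QP _ (Qn _ kQ); rewrite kQ /letter => <-.
  case: (boolP (x \in vt t)) => xvt /=; last first.
    have /negPf-> : k != 0%N by have := Qn _ kQ; rewrite mem_iota; case: (k).
    by rewrite eqxx.
  have [/eqP|_] := eqVneq k (nth 0%N Q (index x (vt t))); last by rewrite eqxx.
  rewrite nth_uniq ?szQ //; last by rewrite -(szvt t) index_mem.
  by move=> /eqP-> _; rewrite nth_index.
Qed.

(** In the monomial z S y S^c put 1 for the variables outside T, the common letter
    for those in T, and start z so that the special letter of y must be read last.
    The value is nonzero exactly when no variable of T comes after y, that is,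
    when T is included in S; ranking by cardinality makes this triangular. *)
Lemma codim_unitization_track_ge i n : (n < per i)%N -> (per i < len i)%N ->
  (2 ^ n <= codim (unitization A) n.+2)%N.
Proof.
set p := per i => n_lt_p p_len.
have <- : #|{: {set 'I_n}}| = (2 ^ n)%N.
  by rewrite -cardsT -powersetT card_powerset cardsT card_ord.
pose vs (S : {set 'I_n}) := [seq (val x).+2 | x <- enum S].
have mem_vs S (x : 'I_n) : ((val x).+2 \in vs S) = (x \in S).
  rewrite /vs (mem_map (f := fun x : 'I_n => (val x).+2)) ?mem_enum //.
  by move=> y z [] /val_inj.
have uvs S : uniq (vs S) by rewrite map_inj_uniq ?enum_uniq // => y z [] /val_inj.
have vsP S k : k \in vs S -> exists2 x : 'I_n, x \in S & k = (val x).+2.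
  by move=> /mapP[x]; rewrite mem_enum => xS ->; exists x.
pose w S := vs S ++ 1%N :: vs (~: S)%SET.
(* The variables 0 and 1 are z and y. *)
pose kept (T : {set 'I_n}) : pred nat := fun x => (x < 2)%N || (x \in vs T).
pose y (T : {set 'I_n}) x : A := if x == 0%N then start i (p - #|T|.+1)%N else
  if x == 1%N then step p else step 0.
pose a T x : unitization A := if kept T x then (0, y T x) else (1, 0).
pose psi T f := track_coord i p (eval (a T) f).2.
pose g S : freeAlg F := << lmon 0 (w S) >>.
pose u T S := seq.filter (kept T) (w S).
have wP S : perm_eq (0%N :: w S) (iota 0 n.+2).
  apply: uniq_perm; last 1 first.
  - move=> k; rewrite inE /w mem_cat inE mem_iota add0n.
    case: k => [|[|k]] //; first by rewrite orbT.
    rewrite !(orFb, orbF) /= ltnS ltnS; apply/orP/idP => [|kn].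
      by case=> /vsP[x _ [->]].
    rewrite -[k]/(val (Ordinal kn)) !mem_vs inE; exact/orP/orbN.
  - have N0 : 0%N \notin w S.
      by rewrite mem_cat inE !negb_or; apply/and3P; split=> //; apply/negP => /vsP[].
    rewrite cons_uniq N0 cat_uniq uvs cons_uniq uvs andbT /=.
    have vs1 S' : 1%N \notin vs S' by apply/negP => /vsP[].
    rewrite negb_or !vs1 andbT /=; apply/hasPn => k /vsP[x].
    by rewrite inE => xS ->; rewrite mem_vs.
  - exact: iota_uniq.
have u_perm T S : perm_eq (u T S) (1%N :: vs T).
  have uu : uniq (u T S).
    have := perm_uniq (wP S); rewrite iota_uniq => /andP[_ uw].
    exact: filter_uniq.
  apply: uniq_perm => //=.
    by rewrite uvs andbT; apply/negP => /vsP[].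
  move=> k; rewrite mem_filter inE /kept.
  have := perm_mem (wP S) k; rewrite inE mem_iota add0n.
  case: k => [|[|k]] //=.
  - have := perm_uniq (wP S); rewrite iota_uniq cons_uniq => /andP[/negPf-> _ _].
    by apply/esym/negP => /vsP[].
  - move=> ->; case kT: (_ \in vs T) => //=.
    by have [x _ [->]] := vsP _ _ kT; rewrite !ltnS; apply: (ltn_ord x).
have szu T S : size (u T S) = #|T|.+1.
  by rewrite (perm_size (u_perm T S)) /= size_map -cardE.
have T_lt_p (T : {set 'I_n}) : (#|T| < p)%N.
  by apply: leq_ltn_trans n_lt_p; rewrite -[leqRHS]card_ord max_card.
have psi_g T S : psi T (g S) = \prod_(k <- iota 1 #|T|.+1)
    (y T (nth 0%N (0%N :: u T S) k)).2 (letter per i (p - #|T|.+1 + k)%N).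
  rewrite /psi /track_coord evalU eval_lmon_unitization // -/(u T S) /=.
  have {1}-> : p = (p - #|T|.+1 + size (u T S))%N by rewrite szu subnK.
  by rewrite eval_lmon_start // ?szu // subnK.
apply: (codim_ge_card (g := g) (psi := psi) (r := fun S => #|S|)).
- by move=> S; apply: Pn_malgU; rewrite /multilinear leaves_lmon.
- by move=> T c f1 f2 _ _; rewrite /psi /eval linearP pair_lin2 linearP.
- by move=> T f _ fId; rewrite /psi fId linear0.
- move=> T; rewrite psi_g.
  have -> : u T T = rcons (vs T) 1%N.
    rewrite /u /w filter_cat /= -cats1; congr (_ ++ _).
      by apply/all_filterP/allP => k kT; rewrite /kept kT orbT.
    congr cons; apply/eqP; rewrite -[_ == _]negbK -has_filter; apply/hasPn => k.
    by move=> /vsP[x]; rewrite inE => xT ->; rewrite /kept mem_vs.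
  have szT : size (vs T) = #|T| by rewrite size_map -cardE.
  rewrite prodf_seq_neq0; apply/allP => k; rewrite mem_iota add1n ltnS.
  case: k => // k /=; rewrite ltnS => kT; rewrite nth_rcons szT.
  move: kT; rewrite leq_eqVlt => /orP[/eqP->|kT].
    by rewrite ltnn eqxx subnK // /letter dvdnn /y /= eqxx oner_neq0.
  rewrite kT; have /vsP[x _ ->] : nth 0%N (vs T) k \in vs T by rewrite mem_nth ?szT.
  rewrite /letter gtnNdvd /y /= ?eqxx ?oner_neq0 // ?addnS //.
  by rewrite -addnS -ltn_subRL subKn.
- move=> S T; rewrite psi_g prodf_seq_neq0 => /allP nz ST.
  apply: proper_card; rewrite finset.properEneq eq_sym ST /=.
  have /nz : #|T|.+1 \in iota 1 #|T|.+1 by rewrite mem_iota add1n !ltnS leqnn.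
  rewrite /= subnK // /letter dvdnn; set x := nth _ _ _.
  have xu : x \in u T S by rewrite mem_nth ?szu.
  have p_gt0 : p != 0%N by rewrite -lt0n (leq_trans _ (T_lt_p T)).
  rewrite /y; have [x0|_] /= := eqVneq x 0%N; first by rewrite eqxx.
  have [x1 _|_] /= := eqVneq x 1%N; last by rewrite (negPf p_gt0) eqxx.
  have xlast : x = last 0%N (u T S) by rewrite /x -nth_last szu.
  apply/fintype.subsetP => z zT; apply/negPn/negP => zS.
  have : last 0%N (u T S) \in vs (~: S)%SET.
    rewrite /u /w filter_cat /= last_cat /=.
    have zf : (val z).+2 \in seq.filter (kept T) (vs (~: S)%SET).
      by rewrite mem_filter /kept !mem_vs inE zT.
    case E: (seq.filter _ _) zf => [//|k s] _ /=.
    have : last k s \in seq.filter (kept T) (vs (~: S)%SET) by rewrite E mem_last.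
    by rewrite mem_filter => /andP[].
  by rewrite -xlast x1 => /vsP[].
Qed.

End TrackLowerBounds.

(** * Limits of roots *)

Section Limits.
Variable R : realType.
Implicit Types (u : (\bar R)^nat) (x y : R).

Lemma limn_esup_leP u x :
  (forall y, x < y -> exists n0, forall n, (n0 <= n)%N -> (u n <= y%:E)%E) ->
  (limn_esup u <= x%:E)%E.
Proof.
move=> ux; apply/lee_addgt0Pr => e e0; rewrite -EFinD.
have [|n0 n0P] := ux (x + e); first by rewrite ltrDl.
apply: (@le_trans _ _ (ereal_sup (u @` [set n | (n0 <= n)%N]))).
  by apply: ereal_inf_lbound; exists [set n | (n0 <= n)%N] => //; exists n0.
by apply: ge_ereal_sup => _ [n n0n <-]; apply: n0P.
Qed.

Lemma limn_esup_geP u x :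
  (forall y, y < x -> forall n0, exists2 n, (n0 <= n)%N & (y%:E <= u n)%E) ->
  (x%:E <= limn_esup u)%E.
Proof.
move=> ux; apply: le_ereal_inf_tmp => _ [V [n0 _ n0V] <-].
apply/lee_subgt0Pr => e e0; rewrite -EFinB.
have [|n n0n le_yu] := ux (x - e) _ n0; first by rewrite ltrBlDr ltrDl.
by apply: (le_trans le_yu); apply: ereal_sup_ubound; exists n => //; apply: n0V.
Qed.

Lemma limn_einf_geP u x :
  (forall y, y < x -> exists n0, forall n, (n0 <= n)%N -> (y%:E <= u n)%E) ->
  (x%:E <= limn_einf u)%E.
Proof.
move=> ux; rewrite /limn_einf leeNr; apply: limn_esup_leP => y.
rewrite ltrNl => /ux[n0 n0P]; exists n0 => n /n0P.
by rewrite EFinN leeNl.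
Qed.

Lemma limn_einf_leP u x :
  (forall y, x < y -> forall n0, exists2 n, (n0 <= n)%N & (u n <= y%:E)%E) ->
  (limn_einf u <= x%:E)%E.
Proof.
move=> ux; rewrite /limn_einf leeNl; apply: limn_esup_geP => y.
rewrite ltrNr => yx n0; have [n n0n uy] := ux _ yx n0; exists n => //.
by rewrite leeNr.
Qed.

Lemma powR_expK (y : R) n : (0 < n)%N -> 0 <= y -> (y ^+ n) `^ n%:R^-1 = y.
Proof.
move=> n0 y0; rewrite -powR_mulrn // -powRrM divff ?powRr1 //.
by rewrite pnatr_eq0 -lt0n.
Qed.

Lemma root_le (c y : R) n : (0 < n)%N -> 0 <= c -> 0 <= y -> c <= y ^+ n ->
  c `^ n%:R^-1 <= y.
Proof.
move=> n0 c0 y0 cy; rewrite -[leRHS](powR_expK n0 y0).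
by apply: ge0_ler_powR; rewrite ?nnegrE ?invr_ge0 ?exprn_ge0.
Qed.

Lemma root_ge (c y : R) n : (0 < n)%N -> 0 <= y -> y ^+ n <= c ->
  y <= c `^ n%:R^-1.
Proof.
move=> n0 y0 cy; rewrite -[leLHS](powR_expK n0 y0).
apply: ge0_ler_powR; rewrite ?nnegrE ?invr_ge0 ?exprn_ge0 //.
by rewrite (le_trans _ cy) ?exprn_ge0.
Qed.

Lemma bernoulli_ineq (h : R) n : 0 <= h -> 1 + n%:R * h <= (1 + h) ^+ n.
Proof.
move=> h0; elim: n => [|n IHn]; first by rewrite mul0r addr0 expr0.
rewrite exprS; apply: le_trans (ler_wpM2l _ IHn); last by rewrite addr_ge0.
rewrite mulrDl mul1r mulrDr mulr1 -natr1 mulrDl mul1r addrA lerD2l.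
by rewrite lerDl mulr_ge0 // mulr_ge0.
Qed.

(** Induction on k, writing y as a square: one factor sqrt y ^ n absorbs n ^ k, and
    the other one absorbs the additional n by Bernoulli. *)
Lemma poly_le_exp (C y : R) k : 0 <= C -> 1 < y ->
  exists n0, forall n, (n0 <= n)%N -> C * n%:R ^+ k <= y ^+ n.
Proof.
elim: k C y => [|k IHk] C y C0 y1.
  have h0 : 0 < y - 1 by rewrite subr_gt0.
  exists (Num.truncn (C / (y - 1))).+1 => n n0n; rewrite expr0 mulr1.
  have -> : y = 1 + (y - 1) by rewrite addrC subrK.
  apply: le_trans (bernoulli_ineq _ (ltW h0)).
  rewrite -[leLHS]add0r lerD // -ler_pdivrMr //.
  by apply/ltW/(lt_le_trans (truncnS_gt _)); rewrite ler_nat.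
have z1 : 1 < Num.sqrt y by rewrite -[ltLHS]sqrtr1 ltr_sqrt // (lt_trans ltr01).
set z := Num.sqrt y in z1.
have yE : y = z * z by rewrite -expr2 sqr_sqrtr // ltW // (lt_trans ltr01).
have h0 : 0 < z - 1 by rewrite subr_gt0.
have [n0 n0P] := IHk (C / (z - 1)) z (divr_ge0 C0 (ltW h0)) z1.
exists n0 => n /n0P Hn; rewrite yE exprMn.
have zn : n%:R * (z - 1) <= z ^+ n.
  have -> : z = 1 + (z - 1) by rewrite addrC subrK.
  apply: le_trans (bernoulli_ineq _ (ltW h0)).
  by rewrite [X in _ * (X - 1)]addrC addrK lerDr.
have -> : C * n%:R ^+ k.+1 = (C / (z - 1) * n%:R ^+ k) * (n%:R * (z - 1)).
  rewrite exprSr; set X := n%:R ^+ k; set Y := n%:R.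
  by field; apply: lt0r_neq0.
apply: ler_pM => //.
  by rewrite mulr_ge0 ?divr_ge0 ?exprn_ge0 // ltW.
by rewrite mulr_ge0 // ltW.
Qed.

Lemma poly_exp_le_exp (C x y : R) k : 0 <= C -> 0 < x -> x < y ->
  exists n0, forall n, (n0 <= n)%N -> C * n%:R ^+ k * x ^+ n <= y ^+ n.
Proof.
move=> C0 x0 xy; have [|n0 n0P] := @poly_le_exp C (y / x) k C0.
  by rewrite ltr_pdivlMr // mul1r.
exists n0 => n /n0P; rewrite expr_div_n ler_pdivlMr // exprn_gt0 //.
Qed.

End Limits.

(** * Choice of the periods and the resulting growth *)

Lemma ffact_le_expn n k : (n ^_ k <= n ^ k)%N.
Proof.
elim: k => [|k IHk]; first by rewrite ffactn0.
by rewrite ffactnSr expnSr leq_mul // leq_subr.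
Qed.

Lemma ffact_ge_expn n k : ((n - k) ^ k <= n ^_ k)%N.
Proof.
suff H j : (j <= k)%N -> ((n - k) ^ j <= n ^_ j)%N by apply: H.
elim: j => [|j IHj] jk; first by rewrite ffactn0.
by rewrite ffactnSr expnSr leq_mul ?IHj ?leq_sub2l // ltnW.
Qed.

Lemma bin_le_expn n k : ('C(n, k) <= n ^ k)%N.
Proof.
apply: leq_trans (ffact_le_expn n k); rewrite -bin_ffact.
by rewrite leq_pmulr // fact_gt0.
Qed.

(** With n = 16 ^ L, this bounds n ^ (2 L) by 2 ^ n: it makes the degrees k < L
    negligible in the unital codimension of degree n. *)
Lemma pow16_expn_le L : ((16 ^ L) ^ (2 * L) <= 2 ^ (16 ^ L))%N.
Proof.
have L4 : (3 * L <= 4 ^ L)%N.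
  elim: L => // L IHL; rewrite expnS mulnS.
  by have := expn_gt0 4 L; move: IHL; set X := (4 ^ L)%N; lia.
rewrite -[16%N]/(2 ^ 4)%N -!expnM leq_pexp2l //.
rewrite [X in (_ <= X)%N]expnM -[(2 ^ 4)%N]/(4 * 4)%N expnMn.
apply: leq_trans (leq_mul L4 L4).
by nia.
Qed.

Section Growth.
Variables (F : fieldType) (R : realType) (alpha : R).
Hypothesis alpha_gt1 : 1 < alpha.

Definition cutoff p : nat := Num.truncn (alpha ^+ p).

(** The next period is an exponential of the previous length, for the gap used in
    [codim_unitization_le_at_per]; adding per j keeps the sequence increasing even
    while cutoff p < p, which can happen for small p when alpha is close to 1. *)
Fixpoint per i : nat :=
  if i is j.+1 then (16 ^ (cutoff (per j) + per j).+1)%N else 1%N.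

Definition len i : nat := cutoff (per i).

Local Notation A := (trackAlg F per len).
Local Notation c := (fun n => (codim A n)%:R : R).
Local Notation cu := (fun n => (codim (unitization A) n)%:R : R).

Let alpha_gt0 : 0 < alpha. Proof. exact: lt_trans ltr01 alpha_gt1. Qed.
Let alpha_ge1 : 1 <= alpha. Proof. exact: ltW. Qed.

Lemma per_gt0 i : (0 < per i)%N.
Proof. by case: i => //= i; rewrite expn_gt0. Qed.

Lemma per_step i : (len i + per i < per i.+1)%N.
Proof. by apply: ltn_trans (ltnSn _) _; apply: ltn_expl. Qed.

Lemma per_lt i j : (i < j)%N -> (len i + per i < per j)%N.
Proof.
elim: j => // j IHj; rewrite ltnS leq_eqVlt => /orP[/eqP->|/IHj ij].
  exact: per_step.
apply: (ltn_trans ij); apply: leq_ltn_trans (per_step j); exact: leq_addl.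
Qed.

Lemma per_ge i : (i < per i)%N.
Proof.
elim: i => // i IHi; apply: leq_ltn_trans IHi _.
by apply: leq_ltn_trans (per_step i); rewrite leq_addl.
Qed.

Lemma le_len n i : (n <= len i)%N -> n%:R <= alpha ^+ per i.
Proof. by rewrite truncn_ge_nat ?exprn_ge0 // ltW. Qed.

(** In this range the tracks up to j are too short, and the later ones have periods
    at least n. *)
Lemma codim_le_cube_between j n : (1 < n)%N -> (len j + per j < n <= per j.+1)%N ->
  (codim A n <= n ^ 3)%N.
Proof.
move=> n1 /andP[jn nj]; apply: codim_track_le_cube => // i.
have [ij|ji] := leqP i j; last first.
  rewrite (leq_trans nj) //; move: ji; rewrite leq_eqVlt => /orP[/eqP<-//|].
  by move=> /per_lt ji; apply/ltnW/(leq_ltn_trans _ ji)/leq_addl.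
apply/orP; right; apply: leq_ltn_trans jn.
move: ij; rewrite leq_eqVlt => /orP[/eqP->|/per_lt ij]; first exact: leq_addr.
apply: leq_trans (leq_addl _ _); apply: ltnW; apply: leq_ltn_trans ij.
exact: leq_addr.
Qed.

(** By sparsity at most one track, the first with n <= len i, can have several
    special letters in a window of length n; then n <= alpha ^ p turns
    n ^ (n / p) into at most alpha ^ n. *)
Lemma codim_le_exp n : c n <= 2 * n%:R ^+ 3 * alpha ^+ n.
Proof.
case: n => [|[|n']]; first by rewrite codim0 !mulr_ge0 // exprn_ge0 // ltW.
  apply: (@le_trans _ _ 1); first by rewrite -[leRHS]/(1%:R) ler_nat codim1_le1.
  by rewrite expr1n mulr1 expr1 -[leLHS]mulr1 ler_pM // ler1n.
set n := n'.+2; have n1 : (1 < n)%N by [].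
have an1 : 1 <= alpha ^+ n by rewrite exprn_ege1.
have few_le : (codim A n <= n ^ 3)%N -> c n <= 2 * n%:R ^+ 3 * alpha ^+ n.
  rewrite -(ler_nat R) natrX => /le_trans; apply.
  by rewrite mulrAC ler_peMl ?exprn_ge0 // -[leLHS]mulr1 ler_pM // ler1n.
have [[i in_]|none] := pselect (exists i, n <= len i)%N; last first.
  apply/few_le/codim_track_le_cube => // i; rewrite orbC ltnNge.
  by case: leqP => //= ni; case: none; exists i.
have ex : exists i, (n <= len i)%N by exists i.
case: (ex_minnP ex) => {i in_} i0 ni0 i0min.
have others i : i != i0 -> (n <= per i)%N || (len i < n)%N.
  rewrite neq_ltn => /orP[ii0|/per_lt i0i].
    by rewrite orbC ltnNge; case: leqP => // /i0min; rewrite leqNgt ii0.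
  by rewrite (leq_trans ni0) // ltnW // (leq_ltn_trans _ i0i) // leq_addr.
have [np|pn] := leqP n (per i0).
  apply/few_le/codim_track_le_cube => // i.
  by have [->|/others] := eqVneq i i0; rewrite ?np.
have := codim_track_le_dense F n1 (per_gt0 i0) others.
rewrite -(ler_nat R) natrD natrM !natrX => /le_trans; apply.
set p := per i0 in pn *; rewrite exprD.
have npow : n%:R ^+ (n %/ p) <= alpha ^+ n.
  apply: le_trans (_ : (alpha ^+ p) ^+ (n %/ p) <= _).
    by rewrite lerXn2r ?nnegrE ?exprn_ge0 ?le_len // ltW.
  by rewrite -exprM ler_weXn2l // mulnC leq_trunc_div.
have -> : 2 * n%:R ^+ 3 * alpha ^+ n =
  n%:R ^+ 3 * alpha ^+ n + n%:R * (alpha ^+ n * n%:R ^+ 2) :> R by ring.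
rewrite lerD //; first by rewrite ler_peMr ?exprn_ge0.
rewrite ler_pM ?mulr_ge0 ?exprn_ge0 // ?ler_nat 1?ltnW //.
by rewrite ler_wpM2r ?exprn_ge0.
Qed.

Lemma codim_unitization_le_sum n :
  cu n <= 1 + \sum_(k < n.+1) 'C(n, k)%:R * c k.
Proof.
have := codim_unitization_le A n; rewrite -(ler_nat R) natrD natr_sum.
by under eq_bigr do rewrite natrM.
Qed.

Lemma codim_unitization_le_exp n : (0 < n)%N ->
  cu n <= 3 * n%:R ^+ 3 * (alpha + 1) ^+ n.
Proof.
move=> n0; apply: le_trans (codim_unitization_le_sum n) _.
have n1 : 1 <= n%:R ^+ 3 :> R by rewrite exprn_ege1 // ler1n.
have an1 : 1 <= (alpha + 1) ^+ n by rewrite exprn_ege1 // lerDr ltW.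
have -> : 3 * n%:R ^+ 3 * (alpha + 1) ^+ n = n%:R ^+ 3 * (alpha + 1) ^+ n +
  2 * n%:R ^+ 3 * (alpha + 1) ^+ n by ring.
apply: lerD; first by rewrite -[leLHS]mulr1 ler_pM.
rewrite addrC exprDn mulr_sumr; apply: ler_sum => k _.
rewrite expr1n mul1r -[alpha ^+ k *+ _]mulr_natl [leRHS]mulrCA ler_wpM2l //.
apply: le_trans (codim_le_exp k) _; rewrite ler_wpM2r ?exprn_ge0 ?(ltW alpha_gt0) //.
rewrite ler_wpM2l // lerXn2r ?nnegrE // ler_nat -ltnS; exact: ltn_ord.
Qed.

(** With L the exponent of 16 in per (j + 1), terms with k >= L are handled by
    [codim_le_cube_between]; for k < L the term is polynomial in n times
    (n alpha) ^ k <= n ^ (2 L) <= 2 ^ n. *)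
Lemma codim_unitization_le_at_per j : alpha <= (per j.+1)%:R ->
  cu (per j.+1) <= 6 * (per j.+1)%:R ^+ 4 * 2 ^+ (per j.+1).
Proof.
set n := per j.+1 => le_an; set L := (cutoff (per j) + per j).+1.
have n0 : (0 < n)%N by apply: per_gt0.
have nL : (n ^ (2 * L) <= 2 ^ n)%N by exact: pow16_expn_le.
(* From here on the explicit power of 16 must not be unfolded. *)
have n_le : (n <= per j.+1)%N by [].
clearbody n.
apply: le_trans (codim_unitization_le_sum n) _.
have n1 : 1 <= n%:R :> R by rewrite ler1n.
have two1 : 1 <= 2 ^+ n :> R by rewrite exprn_ege1 // ler1n.
apply: (@le_trans _ _ (1 + \sum_(k < n.+1)
    (2 * n%:R ^+ 3 * 2 ^+ n + 'C(n, k)%:R * n%:R ^+ 3))).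
  rewrite lerD2l; apply: ler_sum => k _.
  have kn : (k <= n)%N by rewrite -ltnS ltn_ord.
  have kn3 : k%:R ^+ 3 <= n%:R ^+ 3 :> R by rewrite lerXn2r ?nnegrE // ler_nat.
  have [kL|Lk] := ltnP k L.
    rewrite -[leLHS]addr0 lerD ?mulr_ge0 ?exprn_ge0 //.
    apply: (@le_trans _ _ (n%:R ^+ k * (2 * n%:R ^+ 3 * n%:R ^+ k))).
      rewrite ler_pM // -?natrX ?ler_nat ?bin_le_expn //.
      apply: le_trans (codim_le_exp k) _; rewrite !natrX.
      apply: ler_pM; rewrite ?mulr_ge0 ?exprn_ge0 ?(ltW alpha_gt0) //.
        by rewrite ler_wpM2l.
      by rewrite lerXn2r ?nnegrE ?(ltW alpha_gt0).
    rewrite mulrCA ler_wpM2l ?mulr_ge0 ?exprn_ge0 // -exprD -!natrX ler_nat.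
    by apply: leq_trans nL; rewrite leq_pexp2l // addnn -mul2n leq_mul2l /= ltnW.
  rewrite -[leLHS]add0r lerD ?mulr_ge0 ?exprn_ge0 //.
  rewrite ler_wpM2l // (le_trans _ kn3) // -natrX ler_nat.
  apply: (@codim_le_cube_between j); rewrite ?(leq_trans kn n_le) ?andbT //.
  by apply: leq_trans Lk; rewrite /L ltnS addn_gt0 per_gt0 orbT.
rewrite big_split /= sumr_const card_ord -[X in _ + (_ + X)]mulr_suml -natr_sum.
have -> : (\sum_(k < n.+1) 'C(n, k) = 2 ^ n)%N.
  rewrite -[2%N]/(1 + 1)%N expnDn; apply: eq_bigr => k _.
  by rewrite !exp1n !muln1.
rewrite natrX -[_ *+ _]mulr_natl -natr1.
set x : R := n%:R in n1 *; set y : R := 2 ^+ n in two1 *.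
have x3 : x ^+ 3 <= x ^+ 4 by rewrite ler_weXn2l.
have x4 : 1 <= x ^+ 4 by rewrite exprn_ege1.
have -> : 6 * x ^+ 4 * y = x ^+ 4 * y + ((x + 1) * (2 * x ^+ 3 * y) + y * x ^+ 3) +
    3 * (x ^+ 4 - x ^+ 3) * y by ring.
rewrite -[leLHS]addr0; apply: lerD; last first.
  by rewrite !mulr_ge0 ?subr_ge0 // (le_trans _ two1).
by rewrite lerD2r -[leLHS]mulr1 ler_pM.
Qed.

End Growth.

(** * The exponents *)

Section CodimExponents.
Variables (F : fieldType) (R : realType) (B : naAlgType F).
Implicit Types x y : R.

Lemma upper_exp_le x : 0 < x ->
  (forall y, x < y -> exists n0, forall n, (n0 <= n)%N ->
    (codim B n)%:R <= y ^+ n) -> (upper_exp R B <= x%:E)%E.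
Proof.
move=> x0 H; apply: limn_esup_leP => y xy; have [n0 n0P] := H y xy.
(* Degree 0 is excluded: its root is a power with exponent 0^-1 = 0. *)
exists n0.+1 => n n0n; rewrite lee_fin root_le ?(leq_trans _ n0n) //.
  exact: ltW (lt_trans x0 xy).
by apply: n0P; apply: ltnW.
Qed.

Lemma upper_exp_ge x : 1 <= x ->
  (forall y, 1 < y -> y < x -> forall n0, exists2 n, (n0 <= n)%N &
    y ^+ n <= (codim B n)%:R) ->
  (forall n0, exists2 n, (n0 <= n)%N & (0 < codim B n)%N) ->
  (x%:E <= upper_exp R B)%E.
Proof.
move=> x1 H H1; apply: limn_esup_geP => y yx n0; have [y1|y1] := ltP 1 y.
  have [n n0n yn] := H y y1 yx n0.+1; exists n; first exact: ltnW.
  by rewrite lee_fin root_ge ?(leq_trans _ n0n) // ltW // (lt_trans ltr01).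
have [n n0n cn] := H1 n0.+1; exists n; first exact: ltnW.
rewrite lee_fin (le_trans y1) // root_ge ?(leq_trans _ n0n) //.
by rewrite expr1n -[leLHS]/(1%:R) ler_nat.
Qed.

Lemma lower_exp_le x : 0 < x ->
  (forall y, x < y -> forall n0, exists2 n, (n0 <= n)%N &
    (codim B n)%:R <= y ^+ n) -> (lower_exp R B <= x%:E)%E.
Proof.
move=> x0 H; apply: limn_einf_leP => y xy n0; have [n n0n nP] := H y xy n0.+1.
exists n; first exact: ltnW.
rewrite lee_fin root_le ?(leq_trans _ n0n) //.
exact: ltW (lt_trans x0 xy).
Qed.

Lemma lower_exp_ge x : 0 < x ->
  (forall y, 0 < y -> y < x -> exists n0, forall n, (n0 <= n)%N ->
    y ^+ n <= (codim B n)%:R) -> (x%:E <= lower_exp R B)%E.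
Proof.
move=> x0 H; apply: limn_einf_geP => y yx; have [y0|y0] := ltP 0 y.
  have [n0 n0P] := H y y0 yx; exists n0.+1 => n n0n.
  rewrite lee_fin root_ge ?(leq_trans _ n0n) ?(ltW y0) //; exact: n0P (ltnW n0n).
by exists 0%N => n _; rewrite lee_fin (le_trans y0) // powR_ge0.
Qed.

End CodimExponents.

Section Exponents.
Variables (F : fieldType) (R : realType) (alpha : R) (alpha_gt1 : 1 < alpha).

Local Notation per := (per alpha).
Local Notation len := (len alpha).
Local Notation A := (trackAlg F per len).

Let alpha_gt0 : 0 < alpha. Proof. exact: lt_trans ltr01 alpha_gt1. Qed.

Lemma cutoff_gt_linear K : exists p0, forall p, (p0 <= p)%N -> (K * p < cutoff alpha p)%N.
Proof.
have [p0 p0P] := @poly_le_exp R K.+1%:R alpha 1 (ler0n _ _) alpha_gt1.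
exists p0.+1 => p p0p; rewrite truncn_ge_nat ?exprn_ge0 ?(ltW alpha_gt0) //.
apply: le_trans (p0P _ (ltnW p0p)); rewrite expr1 -natrM ler_nat.
by rewrite mulSn -add1n leq_add // (leq_trans _ p0p).
Qed.

Lemma per_large p0 : exists2 i, (0 < i)%N & (p0 <= per i)%N.
Proof. by exists p0.+1 => //; apply: ltnW; apply: ltnW; apply: per_ge. Qed.

Lemma codim_track_gt0 n : (0 < n)%N -> (0 < codim A n)%N.
Proof.
case: n => // n _; have [p0 p0P] := cutoff_gt_linear 1.
have [i _] := per_large (maxn p0 n.+1); rewrite geq_max => /andP[p0i ni].
have := p0P _ p0i; rewrite mul1n => per_len.
have := codim_track_ge F (len := len) (per_gt0 alpha i) (leq_ltn_trans (ltnW ni) per_len).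
by apply: leq_trans; rewrite divn_small // ffactn0.
Qed.

Lemma leq_double_sub m q : (2 * q <= m)%N -> (m <= 2 * (m - q))%N.
Proof. by lia. Qed.

Lemma exponent_bounds K p q m :
  (K.+2 * 2 * p < m.+1)%N -> (m < p * q + p)%N ->
  (m.+1 <= p.*2 + p * q)%N /\ (K * p.*2 <= p * q)%N.
Proof. by nia. Qed.

(** In degree n = len i, with p = per i and q the integer part of (n - 1) / p, the
    falling factorial is at least (n/2 - 1) ^ q. Between y and alpha there is room
    for a b with b ^ p <= n/2 - 1, and p q differs from n by at most p, so
    b ^ (p q) still exceeds y ^ n. *)
Lemma codim_track_exp y : 1 < y -> y < alpha ->
  forall n0, exists2 n, (n0 <= n)%N & y ^+ n <= (codim A n)%:R.
Proof.
move=> y1 ya n0; have y0 : 0 < y := lt_trans ltr01 y1.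
pose b := (y + alpha) / 2.
have yb : y < b by rewrite /b; lra.
have ba : b < alpha by rewrite /b; lra.
have b0 : 0 < b := lt_trans y0 yb.
clearbody b.
(* K factors b / y outweigh each of the factors y of y ^ n in excess of y ^ (p q). *)
have [K KP] : exists K, y <= (b / y) ^+ K.
  have [|K KP] := @poly_le_exp R y (b / y) 0 (ltW y0).
    by rewrite ltr_pdivlMr // mul1r.
  by exists K; have := KP K (leqnn K); rewrite expr0 mulr1.
have [p1 p1P] := @poly_exp_le_exp R 6 b alpha 0 (ler0n _ 6) b0 ba.
have [p2 p2P] := cutoff_gt_linear (K.+2 * 2).
have [i _] := per_large (maxn (maxn p1 p2) (maxn 2 n0)).
rewrite !geq_max => /andP[/andP[ip1 ip2] /andP[i2 in0]].
have {p2P} := p2P _ ip2; have {p1P} := p1P _ ip1.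
rewrite expr0 mulr1; set p := per i in i2 in0 * => p_big len_big.
have len_ge : alpha ^+ p < (cutoff alpha p).+1%:R by apply: truncnS_gt.
exists (cutoff alpha p).
  by apply: (leq_trans in0); apply: leq_trans (ltnW len_big); rewrite leq_pmull.
have p0 : (0 < p)%N by apply: leq_trans i2.
case E: (cutoff alpha p) len_big len_ge => [//|m] len_big len_ge.
have := @codim_track_ge F per len i m p0; rewrite /len -/p E => /(_ (leqnn _)).
rewrite -(ler_nat R); apply: le_trans.
set q := (m %/ p)%N.
have qm : (2 * q <= m)%N.
  by rewrite mulnC; apply: leq_trans (leq_trunc_div m p); rewrite leq_mul2l i2 orbT.
have b_le : b ^+ p <= (m - q)%:R.
  have b1 : 1 <= b ^+ p by rewrite exprn_ege1 // ltW // (lt_trans y1).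
  have mq : m%:R <= 2 * (m - q)%:R :> R by rewrite -natrM ler_nat leq_double_sub.
  move: len_ge; rewrite -addn2 natrD => len_ge.
  by lra.
have pq_lt : (m < p * q + p)%N by rewrite mulnC {1}(divn_eq m p) ltn_add2l ltn_pmod.
have step1 : y ^+ m.+1 <= b ^+ (p * q).
  have [le1 le2] := exponent_bounds len_big pq_lt.
  apply: le_trans (ler_weXn2l (ltW y1) le1) _.
  rewrite exprD -ler_pdivlMr ?exprn_gt0 // -expr_div_n.
  apply: le_trans (_ : ((b / y) ^+ K) ^+ p.*2 <= _).
    by rewrite lerXn2r ?nnegrE ?exprn_ge0 ?divr_ge0 ?(ltW y0) ?(ltW b0).
  by rewrite -exprM ler_weXn2l // ler_pdivlMr // mul1r ltW.
apply: (le_trans step1).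
rewrite exprM; apply: (@le_trans _ _ (((m - q) ^ q)%N%:R)).
  by rewrite natrX lerXn2r ?nnegrE ?exprn_ge0 // ltW.
by rewrite ler_nat ffact_ge_expn.
Qed.

Lemma upper_exp_track : upper_exp R A = alpha%:E.
Proof.
apply/eqP; rewrite eq_le; apply/andP; split.
  apply: upper_exp_le => // y ay.
  have [n0 n0P] := @poly_exp_le_exp R 2 alpha y 3 (ler0n _ 2) alpha_gt0 ay.
  by exists n0 => n /n0P; apply: le_trans; apply: codim_le_exp.
apply: upper_exp_ge; [exact: ltW|exact: codim_track_exp|].
by move=> n0; exists n0.+1 => //; apply: codim_track_gt0.
Qed.

Lemma lower_exp_track : lower_exp R A = 1%:E.
Proof.
apply/eqP; rewrite eq_le; apply/andP; split.
  apply: lower_exp_le => // y y1 n0.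
  have [n1 n1P] := @poly_le_exp R 1 y 3 ler01 y1.
  have [[//|i] _] := per_large (maxn 2 (maxn n0 n1)).
  rewrite !geq_max => /and3P[i2 in0 in1]; exists (per i.+1) => //.
  apply: le_trans (n1P _ in1); rewrite mul1r -natrX ler_nat.
  by apply: (@codim_le_cube_between F R alpha i); rewrite ?per_step ?leqnn.
apply: lower_exp_ge => // y y0 y1; exists 1%N => n n1.
apply: (@le_trans _ _ 1); first by rewrite exprn_ile1 // ltW.
by rewrite -[leLHS]/(1%:R) ler_nat codim_track_gt0.
Qed.

Lemma lower_exp_unitization : lower_exp R (unitization A) = 2%:E.
Proof.
apply/eqP; rewrite eq_le; apply/andP; split.
  apply: lower_exp_le => // y y2 n0.
  have [n1 n1P] := @poly_exp_le_exp R 6 2 y 4 (ler0n _ 6) (ltr0n _ 2) y2.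
  have [[//|i] _] := per_large (maxn (Num.truncn alpha).+1 (maxn n0 n1)).
  rewrite !geq_max => /and3P[ia in0 in1]; exists (per i.+1) => //.
  apply: le_trans (n1P _ in1); apply: codim_unitization_le_at_per => //.
  by apply/ltW/(lt_le_trans (truncnS_gt _)); rewrite ler_nat.
apply: lower_exp_ge => // y y0 y2.
have [n0 n0P] := @poly_exp_le_exp R 4 y 2 0 (ler0n _ 4) y0 y2.
exists (maxn n0 2) => n; rewrite geq_max => /andP[n0n n2].
have [p0 p0P] := cutoff_gt_linear 1.
have [i _] := per_large (maxn p0 n); rewrite geq_max => /andP[p0i ni].
have := p0P _ p0i; rewrite mul1n => per_len.
case: n n2 n0n ni => [|[|n]] // _ n0n ni.
have := codim_unitization_track_ge F (len := len) (ltnW ni) per_len.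
rewrite -(ler_nat R) natrX; apply: le_trans.
have := n0P _ n0n; rewrite expr0 mulr1 !exprS => H; lra.
Qed.

Lemma upper_exp_unitization :
  (alpha%:E <= upper_exp R (unitization A) <= (alpha + 1)%:E)%E.
Proof.
apply/andP; split.
  apply: upper_exp_ge; first exact: ltW.
    move=> y y1 ya n0; have [n n0n yn] := codim_track_exp y1 ya n0; exists n => //.
    by apply: (le_trans yn); rewrite ler_nat codim_le_unitization.
  move=> n0; exists n0.+1 => //; apply: leq_trans (codim_le_unitization _ _).
  exact: codim_track_gt0.
have a1 : 0 < alpha + 1 by apply: addr_gt0.
apply: upper_exp_le => // y ay.
have [n0 n0P] := @poly_exp_le_exp R 3 (alpha + 1) y 3 (ler0n _ 3) a1 ay.
exists n0.+1 => n n0n; apply: le_trans (n0P _ (ltnW n0n)).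
by apply: codim_unitization_le_exp; rewrite // (leq_trans _ n0n).
Qed.

End Exponents.

Theorem theorem3p1 (F : fieldType) (R : realType) (alpha : R) :
  [pchar F] =i pred0 -> 1 < alpha ->
  exists A : naAlgType F,
    [/\ lower_exp R A = 1%:E, upper_exp R A = alpha%:E,
        lower_exp R (unitization A) = 2%:E
      & (alpha%:E <= upper_exp R (unitization A) <= (alpha + 1)%:E)%E].
Proof.
move=> _ alpha_gt1; exists (trackAlg F (per alpha) (len alpha)); split.
- exact: lower_exp_track.
- exact: upper_exp_track.
- exact: lower_exp_unitization.
- exact: upper_exp_unitization.
Qed.
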